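(* Let $(R^6,D)$ be a Borel geometry, with canonical decompositions $D=V\oplus\sqrt D$ and $\sqrt D=L_1\oplus L_2$. The map $\Gamma(L_1)\times\Gamma(L_2)\to\Gamma(V)$ given by $$(X,Y)\mapsto\operatorname{proj}_V([X,Y])$$ is tensorial, and so determines a vector bundle map $\Phi:L_1\otimes L_2\to V$. Geometrically, $\Phi$ is the obstruction to Frobenius-integrability of $\sqrt D$ (i.e. $\sqrt D$ is Frobenius-integrable if and only if $\Phi=0$).
   Context: All objects are complex (holomorphic). A Borel geometry $(R^6,D)$ is a $6$-manifold $R$ with a rank $3$ distribution $D\subset TR$ whose weak derived flag $D^{-1}:=D\subset D^{-2}\subset D^{-3}=TR$ has ranks $(3,5,6)$ and whose symbol algebra $D(x)\oplus(D^{-2}(x)/D(x))\oplus(T_xR/D^{-2}(x))$ at every $x\in R$ (with bracket induced by the Lie bracket of vector fields) is isomorphic as a graded Lie algebra to $\mathfrak m=\mathfrak g_{-1}\oplus\mathfrak g_{-2}\oplus\mathfrak g_{-3}=\langle e_1,e_2,e_3\rangle\oplus\langle e_4,e_5\rangle\oplus\langle e_6\rangle$ with non-trivial brackets $[e_1,e_2]=e_4$, $[e_2,e_3]=e_5$, $[e_1,e_5]=-e_6$, $[e_3,e_4]=e_6$. Canonical objects: $\sqrt D\subset D$ is the canonical rank $2$ subdistribution with $[\sqrt D,\sqrt D]\equiv0\bmod D$; $V\subset D$ is the line field of $X\in\Gamma(D)$ with $[X,\Gamma(D^{-2})]\subset\Gamma(D^{-2})$; $D=V\oplus\sqrt D$,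 and $\operatorname{proj}_V:D\to V$ is the resulting projection. The Lie bracket induces an isomorphism $V\otimes\sqrt D\cong D^{-2}/D$ and a map $\sqrt D\otimes(D^{-2}/D)\to TR/D^{-2}$, whose composition is a non-degenerate conformal symmetric bilinear form on $\sqrt D$ with values in $V^*\otimes(TR/D^{-2})$. $L_1,L_2$ are its two null lines, $\sqrt D=L_1\oplus L_2$ (canonical up to ordering, so $\Phi$ is canonical only up to sign). *)

(* Defs.v *)
(* MathComp-Analysis; the complex numbers are R[i] for R : realType. *)
From mathcomp Require Import all_boot all_order all_algebra.
From mathcomp Require Import all_classical all_reals all_analysis.
From mathcomp.real_closed Require Import complex.

Set Implicit Arguments.
Unset Strict Implicit.
Unset Printing Implicit Defensive.

Import Order.TTheory GRing.Theory Num.Theory.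
Import numFieldNormedType.Exports.

Local Open Scope classical_set_scope.
Local Open Scope ring_scope.
Local Open Scope complex_scope.

(* The carrier is that of an abstract numClosedFieldType, so that the topology
   and the norm of numFieldNormedType apply. *)
Definition Cplx (R : realType) : numClosedFieldType := R[i].
Arguments Cplx : simpl never.

(* [k_holomorphic k U f]: f is k times complex Frechet differentiable at every
   point of U (meant for open U; only the germs of f at points of U matter). *)
Fixpoint k_holomorphic (R : realType) (V W : normedModType (Cplx R)) (k : nat)
    (U : set V) (f : V -> W) : Prop :=
  if k is k'.+1 then
    (forall x, U x -> differentiable f x) /\
    (forall v, k_holomorphic k' U (fun x => 'd f x v))
  else True.

(* Holomorphic = infinitely complex differentiable. On an open set, Cauchy's
   formula makes this the same as being complex differentiable. *)
Definition holomorphic (R : realType) (V W : normedModType (Cplx R))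
    (U : set V) (f : V -> W) : Prop := forall k, k_holomorphic k U f.

(* The atlas is indexed by an arbitrary type. [chart_inv i] is only meaningful
   on the image of [chart i]. [chart_at] selects, for every point, one chart
   around it; it serves to give the tangent spaces below a concrete carrier. *)
Record complex_manifold (R : realType) (n : nat) := ComplexManifold {
  manifold_space :> topologicalType;
  manifold_hausdorff : hausdorff_space manifold_space;
  manifold_second_countable : @second_countable manifold_space;
  chart_index : Type;
  chart_dom : chart_index -> set manifold_space;
  chart : chart_index -> manifold_space -> 'rV[Cplx R]_n;
  chart_inv : chart_index -> 'rV[Cplx R]_n -> manifold_space;
  chart_at : manifold_space -> chart_index;
  chart_at_dom : forall x, chart_dom (chart_at x) x;
  chart_dom_open : forall i, open (chart_dom i);
  chart_image_open : forall i, open (chart i @` chart_dom i);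
  chartK : forall i x, chart_dom i x -> chart_inv i (chart i x) = x;
  chart_continuous : forall i, {within chart_dom i, continuous (chart i)};
  chart_inv_continuous :
    forall i, {within chart i @` chart_dom i, continuous (chart_inv i)};
  transition_holomorphic : forall i j,
    holomorphic (chart i @` (chart_dom i `&` chart_dom j))
                (chart j \o chart_inv i)
}.

Section Manifold.
Variables (R : realType) (n : nat) (M : complex_manifold R n).

Definition holomorphic_fun (U : set M) (f : M -> Cplx R) : Prop :=
  forall i : chart_index M,
    holomorphic (chart i @` (U `&` chart_dom i))
                ((f \o chart_inv i) : 'rV[Cplx R]_n -> (Cplx R)^o).

(* T_x M is 'rV[Cplx R]_n, a tangent vector being given by its components in the
   chart [chart_at x]. *)
Definition vfield := M -> 'rV[Cplx R]_n.

(* Components, in the chart i, of a vector field: X(x) is transported from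
   [chart_at x] to i by the differential of the transition map. *)
Definition in_chart (i : chart_index M) (X : vfield) :
    'rV[Cplx R]_n -> 'rV[Cplx R]_n :=
  fun p => let x := chart_inv i p in
    'd (chart i \o chart_inv (chart_at x)) (chart (chart_at x) x) (X x).

Definition holomorphic_field (U : set M) (X : vfield) : Prop :=
  forall i : chart_index M,
    holomorphic (chart i @` (U `&` chart_dom i)) (in_chart i X).

(* The Lie bracket at x, computed in the chart [chart_at x] by
   [X, Y]^k = X^j d_j Y^k - Y^j d_j X^k. *)
Definition lie (X Y : vfield) : vfield :=
  fun x => let i := chart_at x in let p := chart i x in
    'd (in_chart i Y) p (X x) - 'd (in_chart i X) p (Y x).

Definition subspaces := M -> {vspace 'rV[Cplx R]_n}.

Definition field_in (E : subspaces) (U : set M) (X : vfield) : Prop :=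
  forall x, U x -> X x \in E x.

(* X is an element of Gamma(U, E). All Gamma's are sheaves of local sections,
   since global holomorphic sections may be too few. *)
Definition is_section (E : subspaces) (U : set M) (X : vfield) : Prop :=
  holomorphic_field U X /\ field_in E U X.

Definition distribution (k : nat) (E : subspaces) : Prop :=
  (forall x, \dim (E x) = k) /\
  (forall x, exists (U : set M) (X : k.-tuple vfield),
    [/\ open U, U x, forall j, holomorphic_field U (tnth X j) &
        forall y, U y -> E y = <<[tuple tnth X j y | j < k]>>%VS]).

(* F = E + [D, E]: F x is the smallest subspace containing E x and the values
   at x of the brackets of local sections of D and E. *)
Definition derived_step (D E F : subspaces) : Prop :=
  forall x (W : {vspace 'rV[Cplx R]_n}),
    (F x <= W)%VS <->
    (E x <= W)%VS /\
    (forall (U : set M) (X Y : vfield), open U -> U x ->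
       is_section D U X -> is_section E U Y -> lie X Y x \in W).

(* Involutivity, i.e. the integrability condition of Frobenius. *)
Definition frobenius_integrable (E : subspaces) : Prop :=
  forall (U : set M) (X Y : vfield), open U ->
    is_section E U X -> is_section E U Y -> field_in E U (lie X Y).

(* A holomorphic bundle map from the tensor product of L1 and L2 to V, as a
   family of bilinear maps of the fibres sending local sections to local
   sections. Only the values of Phi x on L1 x and L2 x are meaningful. *)
Definition tensor_bundle_map (L1 L2 V : subspaces)
    (Phi : M -> 'rV[Cplx R]_n -> 'rV[Cplx R]_n -> 'rV[Cplx R]_n) : Prop :=
  [/\ forall x u v, u \in L1 x -> v \in L2 x -> Phi x u v \in V x,
      forall x (a : Cplx R) u u' v, u \in L1 x -> u' \in L1 x -> v \in L2 x ->
        Phi x (a *: u + u') v = a *: Phi x u v + Phi x u' v,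
      forall x (a : Cplx R) u v v', u \in L1 x -> v \in L2 x -> v' \in L2 x ->
        Phi x u (a *: v + v') = a *: Phi x u v + Phi x u v' &
      forall (U : set M) (X Y : vfield), open U ->
        is_section L1 U X -> is_section L2 U Y ->
        is_section V U (fun x => Phi x (X x) (Y x))].

Definition eq_on_tensor (L1 L2 : subspaces)
    (Phi Psi : M -> 'rV[Cplx R]_n -> 'rV[Cplx R]_n -> 'rV[Cplx R]_n) : Prop :=
  forall x u v, u \in L1 x -> v \in L2 x -> Phi x u v = Psi x u v.

End Manifold.

Section Model.
Variable R : realType.

(* One-based indices and basis vectors, e_1, ..., e_6. *)
Definition idx (k : nat) : 'I_6 := inord k.-1.
Definition e_ (k : nat) : 'rV[Cplx R]_6 := delta_mx 0 (idx k).

Definition wedge (k l : nat) (a b : 'rV[Cplx R]_6) : Cplx R :=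
  a 0 (idx k) * b 0 (idx l) - a 0 (idx l) * b 0 (idx k).

(* The bracket of m: [e1,e2] = e4, [e2,e3] = e5, [e1,e5] = -e6, [e3,e4] = e6. *)
Definition m_bracket (a b : 'rV[Cplx R]_6) : 'rV[Cplx R]_6 :=
  wedge 1 2 a b *: e_ 4 + wedge 2 3 a b *: e_ 5
  + (wedge 3 4 a b - wedge 1 5 a b) *: e_ 6.

Definition m_1 : {vspace 'rV[Cplx R]_6} := <<[:: e_ 1; e_ 2; e_ 3]>>%VS.
Definition m_2 : {vspace 'rV[Cplx R]_6} := <<[:: e_ 4; e_ 5]>>%VS.

End Model.

Section Borel.
Variables (R : realType) (M : complex_manifold R 6).

(* The symbol algebra D x + (D2 x / D x) + (T_x M / D2 x) is isomorphic to m as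
   a graded Lie algebra. A graded linear isomorphism from m to the symbol is
   given by a lift s : m -> T_x M to a linear isomorphism which respects the
   filtrations; every bracket in the symbol of a degree below -3 vanishes. *)
Definition symbol_iso_m (D D2 : subspaces M) (x : M) : Prop :=
  exists s : 'End('rV[Cplx R]_6),
  [/\ lker s == 0%VS, (s @: m_1 R)%VS = D x,
      (s @: (m_1 R + m_2 R))%VS = D2 x,
      forall (U : set M) (X Y : vfield M) a b, open U -> U x ->
        is_section D U X -> is_section D U Y ->
        a \in m_1 R -> b \in m_1 R -> X x = s a -> Y x = s b ->
        lie X Y x - s (m_bracket a b) \in D x &
      forall (U : set M) (X Y : vfield M) a b, open U -> U x ->
        is_section D U X -> is_section D2 U Y ->
        a \in m_1 R -> b \in m_2 R -> X x = s a -> Y x - s b \in D x ->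
        lie X Y x - s (m_bracket a b) \in D2 x].

(* D2 is the term D^{-2} of the weak derived flag. *)
Definition borel_geometry (D D2 : subspaces M) : Prop :=
  [/\ distribution 3 D, distribution 5 D2, derived_step D D D2,
      derived_step D D2 (fun=> fullv) & forall x, symbol_iso_m D D2 x].

Definition is_sqrtD (D S : subspaces M) : Prop :=
  [/\ distribution 2 S, forall x, (S x <= D x)%VS &
      forall (U : set M) (X Y : vfield M), open U ->
        is_section S U X -> is_section S U Y -> field_in D U (lie X Y)].

Definition is_V (D D2 V : subspaces M) : Prop :=
  [/\ distribution 1 V, forall x, (V x <= D x)%VS &
      forall (U : set M) (X : vfield M), open U -> is_section D U X ->
        (field_in V U X <->
         forall (U' : set M) (Y : vfield M), open U' -> U' `<=` U ->
           is_section D2 U' Y -> field_in D2 U' (lie X Y))].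

(* The conformal form on sqrt(D) with values in Hom(V, TM / D2),
   (s, t) |-> (v |-> [s, [v, t]] mod D2), vanishes on (s, t) at x; here s, t
   are vectors of S x = sqrt(D)(x). *)
Definition conformal_form_eq0 (D2 V S : subspaces M) (x : M)
    (s t : 'rV[Cplx R]_6) : Prop :=
  forall (U : set M) (X Y Z : vfield M), open U -> U x ->
    is_section S U X -> is_section S U Y -> is_section V U Z ->
    X x = s -> Y x = t -> lie X (lie Z Y) x \in D2 x.

Definition null_lines (D2 V S L1 L2 : subspaces M) : Prop :=
  [/\ distribution 1 L1, distribution 1 L2,
      forall x, directv (L1 x + L2 x) /\ (L1 x + L2 x)%VS = S x &
      forall x s, s \in S x ->
        (conformal_form_eq0 D2 V S x s s <-> s \in L1 x \/ s \in L2 x)].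

(* x |-> proj_V (Z x), the projection onto V along S = sqrt(D); it is used for
   vectors of D = V + S only. *)
Definition projV (V S : subspaces M) (Z : vfield M) : vfield M :=
  fun x => daddv_pi (V x) (S x) (Z x).

End Borel.

(* Main.v *)
Require Import Defs.
From HB Require Import structures.
From mathcomp Require Import all_boot all_order all_algebra.
From mathcomp Require Import all_classical all_reals all_analysis.
From mathcomp Require Import ring lra.
From mathcomp.real_closed Require Import complex.
Set Implicit Arguments.
Unset Strict Implicit.
Unset Printing Implicit Defensive.
Import Order.TTheory GRing.Theory Num.Theory.
Import numFieldNormedType.Exports.
Local Open Scope classical_set_scope.
Local Open Scope ring_scope.

(* In a chart the Lie bracket is dY(X) - dX(Y), and the symmetry of second
   derivatives, obtained from the mean value theorem along real segments, makes
   it independent of the chart and holomorphic.  Locally V, L1 and L2 are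
   spanned by holomorphic fields v, s1, s2, and the coefficients of a section of
   D in this frame are holomorphic by Cramer's rule; hence proj_V [X, Y] is a
   holomorphic section of V.  The Leibniz rule
   [f X, Y] = f [X, Y] - Y(f) X and proj_V X = 0 give the tensoriality.
   Expanding two sections of sqrt(D) = L1 + L2 in the frame s1, s2, their
   bracket is a multiple of [s1, s2] modulo sqrt(D), and [s1, s2] lies in
   sqrt(D) if and only if its projection Phi(s1, s2) vanishes. *)

(** * Iterated differentiability *)

(** Holomorphy means complex differentiability to every order on an open set, so regularity is
    proved order by order, and each bracket costs one order. [lie X Y] at x is read in the chart
    [chart_at x], which may jump with x: chart independence is therefore what gives the bracket a
    single expression near a point, without which its holomorphy cannot even be tested. The mean
    value theorem concerns real functions of a real variable, whence the passage to real parts and,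
    for the imaginary part, to 'i f. A vector of a line is extended to a section only locally and
    not uniquely. The choice is harmless: two extensions differ by a section of the line vanishing
    at x, and the bracket of such a section with any holomorphic field has at x a value in the line,
    which proj_V kills. This is why Phi can be defined vector by vector. *)

Lemma near_is_diff (K : numFieldType) (V W : normedModType K) (f g df : V -> W)
    (x : V) :
  (\near x, f x = g x) -> is_diff x f df -> is_diff x g df.
Proof.
move=> fg [dfx <-].
have cf : continuous ('d f x) by exact: diff_continuous.
have gx : g x = f x by have := nbhs_singleton fg.
(* The differential is characterised by the first-order expansion at x, and this only sees the germ
   of the function. *)
have e : g \o shift x = cst (g x) + 'd f x +o_ 0 id.
  rewrite gx; apply/eqaddoP => _ /posnumP[e].
  have /eqaddoP/(_ e%:num) := diff_locally dfx.
  have /[swap] /[apply] : 0 < e%:num by [].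
  have := fg; rewrite (near_shift 0 x) subr0 => fg0.
  by apply: filterS2 fg0 => z; rewrite !fctE /= => <-.
have dg : 'd g x = 'd f x :> (V -> W) by exact: diff_unique.
by apply: DiffDef => //; apply/diff_locallyP; rewrite dg.
Qed.

Section Scale.
Variables (K : numFieldType) (W : normedModType K).

(** Regarding the scalars as the normed module [K^o] makes scaling a bilinear map between normed
    modules, so that the differential of a continuous bilinear map yields the product rule. *)
Lemma scale_is_bilinear :
  bilinear_for
    (GRing.Scale.Law.clone _ _ *:%R _) (GRing.Scale.Law.clone _ _ *:%R _)
    (@GRing.scale K W : K^o -> W -> W).
Proof.
split=> [u'|u] a x y /=.
- by rewrite scalerDl scalerA.
- by rewrite scalerDr !scalerA mulrC.
Qed.

HB.instance Definition _ :=
  bilinear_isBilinear.Build K K^o W W _ _ (@GRing.scale K W : K^o -> W -> W)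
    scale_is_bilinear.

Lemma is_diff_scale (V : normedModType K) (f df : V -> K^o) (g dg : V -> W) x :
  is_diff x f df -> is_diff x g dg ->
  is_diff x (fun z => f z *: g z) (fun v => f x *: dg v + df v *: g x).
Proof.
move=> dfx dgx.
have sc : continuous (fun p : K^o * W => p.1 *: p.2).
  by move=> p; exact: scale_continuous.
have -> : (fun z => f z *: g z)
   = (fun p : K^o * W => p.1 *: p.2) \o (fun y => (f y, g y)) by [].
pose b : {bilinear K^o -> W -> W} := @GRing.scale K W.
have ds : is_diff (f x, g x) (fun p : K^o * W => p.1 *: p.2)
   (fun q => f x *: q.2 + q.1 *: g x).
  apply: DiffDef.
    exact: (@differentiable_bilin _ _ _ _ b).
  exact: (@diff_bilin _ _ _ _ b (f x, g x)).
exact: is_diff_comp.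
Qed.

End Scale.

Lemma near_differentiable (K : numFieldType) (V W : normedModType K)
    (f g : V -> W) (x : V) :
  (\near x, f x = g x) -> differentiable f x -> differentiable g x.
Proof. by move=> fg /differentiableP/(near_is_diff fg) []. Qed.

Lemma near_diff (K : numFieldType) (V W : normedModType K)
    (f g : V -> W) (x : V) :
  (\near x, f x = g x) -> differentiable f x ->
  'd g x = 'd f x :> (V -> W).
Proof. by move=> fg /differentiableP/(near_is_diff fg) []. Qed.

Lemma diff_linear_comp (K : numFieldType) (V W W' : normedModType K)
    (f : V -> W) (L : {linear W -> W'}) x : continuous L ->
  differentiable f x ->
  is_diff x (fun y => L (f y)) (fun v => L ('d f x v)).
Proof.
move=> cL /differentiableP df.
have dL : is_diff (f x) L L.
  apply: DiffDef; first exact: linear_differentiable.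
  exact: diff_lin.
exact: (@is_diff_comp _ _ _ _ f _ L L).
Qed.

Section KDiff.
Variable K : numFieldType.
Implicit Types V W : normedModType K.

Lemma near_open (T : topologicalType) (U : set T) (P : T -> Prop) x :
  open U -> U x -> (forall y, U y -> P y) -> \near x, P x.
Proof.
by move=> oU Ux UP; apply: filterS UP _; exact: open_nbhs_nbhs.
Qed.

(* [k_holomorphic], with an arbitrary scalar field. *)
Fixpoint k_diff V W (k : nat) (U : set V) (f : V -> W) : Prop :=
  if k is k'.+1 then
    (forall x, U x -> differentiable f x) /\
    (forall v, k_diff k' U (fun x => 'd f x v))
  else True.

(** Openness of U matters: agreement on U is then agreement near each of its points, hence it passes
    to the differentials and the induction can continue. *)
Lemma k_diff_eq V W k (U : set V) (f g : V -> W) : open U ->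
  (forall x, U x -> f x = g x) -> k_diff k U f -> k_diff k U g.
Proof.
move=> oU; elim: k f g => [|k IH]; first by move=> *.
move=> f g fg [df kf].
have nfg x : U x -> \near x, f x = g x by move=> Ux; exact: near_open oU Ux fg.
split=> [x Ux|v].
  exact: near_differentiable (nfg _ Ux) (df _ Ux).
apply: IH (kf v) => x Ux; by rewrite (near_diff (nfg _ Ux) (df _ Ux)).
Qed.

(** No openness of N is required, because differentials are taken in the whole space and [k_diff] is
    a condition at each point separately. *)
Lemma k_diff_local V W k (U : set V) (f : V -> W) :
  (forall x, U x -> exists N : set V, N x /\ k_diff k N f) ->
  k_diff k U f.
Proof.
elim: k f => [|k IH]; first by move=> *.
move=> f loc; split=> [x /loc[N [Nx [+ _]]]|v]; first exact.
by apply: IH => x /loc[N [Nx [_ kN]]]; exists N; split; [exact: Nx|exact: kN].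
Qed.

Lemma k_diff_sub V W k (U N : set V) (f : V -> W) :
  N `<=` U -> k_diff k U f -> k_diff k N f.
Proof. by move=> NU kf; apply: k_diff_local => x /NU Ux; exists U; split. Qed.

Lemma k_diff_pred V W k (U : set V) (f : V -> W) :
  k_diff k.+1 U f -> k_diff k U f.
Proof.
elim: k f => [|k IH]; first by move=> *.
move=> f [df kf]; split; first exact: df.
by move=> v; exact: IH.
Qed.

Lemma k_diff_ext V W k (U : set V) (f g : V -> W) :
  f =1 g -> k_diff k U f -> k_diff k U g.
Proof. by move=> /funext ->. Qed.

Lemma k_diff_cst V W k (U : set V) (c : W) : k_diff k U (fun=> c).
Proof.
elim: k c => [|k IH]; first by move=> *.
move=> c; split=> [x _|v]; first exact: differentiable_cst.
apply: (k_diff_ext _ (IH 0)) => x.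
by rewrite (_ : (fun=> c) = cst c) // diff_cst.
Qed.

Lemma k_diff_lin V W W' k (U : set V) (f : V -> W) (L : {linear W -> W'}) :
  open U -> continuous L ->
  k_diff k U f -> k_diff k U (fun x => L (f x)).
Proof.
move=> oU cL; elim: k f => [|k IH]; first by move=> *.
move=> f [df kf]; split=> [x Ux|v].
  by have [] := diff_linear_comp cL (df _ Ux).
apply: (k_diff_eq oU _ (IH _ (kf v))) => x Ux.
by have [_ ->] := diff_linear_comp cL (df _ Ux).
Qed.

Lemma k_diff_add V W k (U : set V) (f g : V -> W) : open U ->
  k_diff k U f -> k_diff k U g ->
  k_diff k U (fun x => f x + g x).
Proof.
move=> oU; elim: k f g => [|k IH]; first by move=> *.
move=> f g [df kf] [dg kg].
rewrite (_ : (fun x => f x + g x) = f + g)//.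
split=> [x Ux|v].
  by apply: differentiableD; [exact: df | exact: dg].
apply: (k_diff_eq oU _ (IH _ _ (kf v) (kg v))) => x Ux.
by rewrite (diffD (df _ Ux) (dg _ Ux)).
Qed.

(** By the Leibniz rule the derivative is again a sum of two such products; in each, the
    undifferentiated factor is lowered by one order so that the induction hypothesis applies. *)
Lemma k_diff_scale V W k (U : set V) (f : V -> K^o) (g : V -> W) : open U ->
  k_diff k U f -> k_diff k U g ->
  k_diff k U (fun x => f x *: g x).
Proof.
move=> oU; elim: k f g => [|k IH]; first by move=> *.
move=> f g kf kg.
have [df kf'] := kf; have [dg kg'] := kg.
split=> [x Ux|v].
  by have [] := is_diff_scale (differentiableP (df _ Ux))
    (differentiableP (dg _ Ux)).
have kfg := IH _ _ (k_diff_pred kf) (kg' v).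
have kgf := IH _ _ (kf' v) (k_diff_pred kg).
apply: (k_diff_eq oU _ (k_diff_add oU kfg kgf)) => x Ux.
by have [_ ->] := is_diff_scale (differentiableP (df _ Ux))
  (differentiableP (dg _ Ux)).
Qed.

Lemma k_diff_opp V W k (U : set V) (f : V -> W) : open U ->
  k_diff k U f -> k_diff k U (fun x => - f x).
Proof.
move=> oU kf.
apply: (k_diff_eq oU _ (k_diff_scale oU (k_diff_cst k U (-1 : K^o)) kf)).
by move=> x Ux; rewrite scaleN1r.
Qed.

Lemma k_diff_sum V W k (U : set V) I (r : seq I) (P : pred I) (f : I -> V -> W) :
  open U -> (forall i, P i -> k_diff k U (f i)) ->
  k_diff k U (fun x => \sum_(i <- r | P i) f i x).
Proof.
move=> oU kf; elim: r => [|i r IH].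
  apply: (k_diff_eq oU _ (k_diff_cst k U 0)) => x _; by rewrite big_nil.
case Pi : (P i).
  apply: (k_diff_eq oU _ (k_diff_add oU (kf _ Pi) IH)) => x _.
  by rewrite big_cons Pi.
by apply: (k_diff_eq oU _ IH) => x _; rewrite big_cons Pi.
Qed.

Lemma k_diff_prod V k (U : set V) I (r : seq I) (P : pred I) (f : I -> V -> K^o) :
  open U -> (forall i, P i -> k_diff k U (f i)) ->
  k_diff k U (fun x => \prod_(i <- r | P i) f i x : K^o).
Proof.
move=> oU kf; elim: r => [|i r IH].
  apply: (k_diff_eq oU _ (k_diff_cst k U (1 : K^o))) => x _; by rewrite big_nil.
case Pi : (P i).
  apply: (k_diff_eq oU _ (k_diff_scale oU (kf _ Pi) IH)) => x _.
  by rewrite big_cons Pi.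
by apply: (k_diff_eq oU _ IH) => x _; rewrite big_cons Pi.
Qed.

Lemma k_diff_inv V k (U : set V) (f : V -> K^o) : open U ->
  (forall x, U x -> f x != 0) ->
  k_diff k U f -> k_diff k U (fun x => (f x)^-1 : K^o).
Proof.
move=> oU f0; elim: k => [|k IH]; first by move=> *.
move=> kf; have [df kf'] := kf; split=> [x Ux|v].
  exact: (@differentiableV K V f) (df _ Ux) (f0 _ Ux).
have ki := IH (k_diff_pred kf).
(* The derivative of 1/f is - f^-2 df, which involves 1/f only to the order supplied by
   induction. *)
have ki2 := k_diff_scale oU (k_diff_scale oU ki ki) (kf' v).
apply: (k_diff_eq oU _ (k_diff_opp oU ki2)) => x Ux.
rewrite (@diffV K V f x (df _ Ux) (f0 _ Ux)) /=.
by rewrite scaleNr expr2 invfM.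
Qed.

(** Naming the coordinate gives it a linear structure, so that facts on composition with continuous
    linear maps apply to coordinates. *)
Definition mx_entry m n (i : 'I_m) (j : 'I_n) (N : 'M[K]_(m, n)) : K^o := N i j.

Lemma mx_entry_is_linear m n (i : 'I_m) (j : 'I_n) : linear (mx_entry i j).
Proof. by move=> a u v; rewrite /mx_entry !mxE. Qed.

HB.instance Definition _ m n (i : 'I_m) (j : 'I_n) :=
  GRing.isLinear.Build K 'M[K]_(m, n) K^o _ (mx_entry i j)
    (mx_entry_is_linear i j).

Lemma k_diff_coord V m n k (U : set V) (f : V -> 'M[K]_(m, n)) i j : open U ->
  k_diff k U f -> k_diff k U (fun x => f x i j : K^o).
Proof.
move=> oU; apply: (k_diff_lin (L := mx_entry i j)) => //.
exact: coord_continuous.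
Qed.

Lemma diff_coord V m n (f : V -> 'M[K]_(m, n)) x i j : differentiable f x ->
  is_diff x (fun y => f y i j : K^o) (fun v => 'd f x v i j).
Proof. by apply: (diff_linear_comp (L := mx_entry i j)); exact: coord_continuous. Qed.

(** Serves twice in the symmetry of second derivatives: with a coordinate, to reduce to scalar
    functions, and with multiplication by 'i, to reach imaginary parts. *)
Lemma diff2_linear_comp V W W' (U : set V) (f : V -> W) (L : {linear W -> W'}) p u v :
  continuous L -> open U -> U p -> k_diff 2 U f ->
  'd (fun q => 'd (fun y => L (f y)) q u) p v = L ('d (fun q => 'd f q u) p v).
Proof.
move=> cL oU Up [df /(_ u)[d2f _]].
have nE : \near p, L ('d f p u) = 'd (fun y => L (f y)) p u.
  apply: near_open oU Up _ => q Uq.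
  by have [_ ->] := diff_linear_comp cL (df _ Uq).
have [dd E] := diff_linear_comp cL (d2f _ Up).
by rewrite (near_diff nE dd) E.
Qed.

Lemma diff2_coord V m n (U : set V) (f : V -> 'M[K]_(m, n)) i j p u v :
  open U -> U p -> k_diff 2 U f ->
  'd (fun q => 'd (fun y => f y i j : K^o) q u) p v = ('d (fun q => 'd f q u) p v) i j.
Proof. by apply: (diff2_linear_comp (L := mx_entry i j)); exact: coord_continuous. Qed.

Lemma diff2_scale V (U : set V) (f : V -> K^o) (c : K) p u v :
  open U -> U p -> k_diff 2 U f ->
  'd (fun q => 'd (fun y => c * f y : K^o) q u) p v =
  c * 'd (fun q => 'd f q u) p v.
Proof.
apply: (@diff2_linear_comp _ _ _ _ _ ( *:%R c : {linear K^o -> K^o})).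
exact: scaler_continuous.
Qed.

End KDiff.

(** * Brackets and frames in a chart *)

Section Chart.
Variables (K : numFieldType) (n : nat).
Local Notation E := 'rV[K]_n.
Implicit Types (A B X Y : E -> E) (U : set E).

Lemma is_diff_sum (V W : normedModType K) k (f df : 'I_k -> V -> W) x :
  (forall i, is_diff x (f i) (df i)) ->
  is_diff x (fun y => \sum_i f i y) (fun v => \sum_i df i v).
Proof.
move=> dfx; rewrite (_ : (fun y => _) = \sum_i f i); last first.
  by apply/funext => y; rewrite fct_sumE.
rewrite (_ : (fun v => _) = \sum_i df i); last first.
  by apply/funext => y; rewrite fct_sumE.
elim/big_ind2 : _ => //; first exact: is_diff_cst.
by move=> f1 g1 f2 g2 d1 d2; exact: is_diffD.
Qed.

Lemma is_diff_uniq (V W : normedModType K) (f d1 d2 : V -> W) x :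
  is_diff x f d1 -> is_diff x f d2 -> d1 = d2.
Proof. by move=> [_ <-] [_ <-]. Qed.

Lemma diff_row_sum (W : normedModType K) (f : E -> W) q v :
  'd f q v = \sum_j v 0 j *: 'd f q (delta_mx 0 j).
Proof.
rewrite {1}[v]row_sum_delta linear_sum; apply: eq_bigr => j _.
by rewrite linearZ.
Qed.

(** [k_diff] controls differentials in a fixed direction only; expanding the moving direction X q in
    the standard basis leaves products of coordinates of X with such differentials. *)
Lemma k_diff_apply (W : normedModType K) k U (f : E -> W) X : open U ->
  k_diff k.+1 U f -> k_diff k U X -> k_diff k U (fun q => 'd f q (X q)).
Proof.
move=> oU [_ kf] kX.
apply: (k_diff_eq (f := fun q => \sum_j X q 0 j *: 'd f q (delta_mx 0 j))) => //.
  by move=> q _; rewrite [RHS]diff_row_sum.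
apply: k_diff_sum => // j _; apply: k_diff_scale => //; first exact: k_diff_coord.
exact: kf.
Qed.

Lemma is_diff_apply (W : normedModType K) U (f : E -> W) X p : open U -> U p ->
  k_diff 2 U f -> differentiable X p ->
  is_diff p (fun q => 'd f q (X q))
    (fun w => 'd f p ('d X p w) + 'd (fun q => 'd f q (X p)) p w).
Proof.
move=> oU Up [df d2f] dX.
have d2 v : differentiable (fun q => 'd f q v) p by have [+ _] := d2f v; apply.
have -> : (fun q => 'd f q (X q)) =
    (fun q => \sum_j X q 0 j *: 'd f q (delta_mx 0 j)).
  by apply/funext => q; rewrite [LHS]diff_row_sum.
(* The same expansion with coefficients frozen at p: it recognises the sum of second derivatives as
   one differential, the other term of the product rule having coefficient 0. *)
have [_ E2] : is_diff p (fun q => 'd f q (X p))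
    (fun w => \sum_j (X p 0 j *: 'd (fun q => 'd f q (delta_mx 0 j)) p w +
      0 *: 'd f p (delta_mx 0 j))).
  have -> : (fun q => 'd f q (X p)) =
      (fun q => \sum_j X p 0 j *: 'd f q (delta_mx 0 j)).
    by apply/funext => q; rewrite [LHS]diff_row_sum.
  apply: is_diff_sum => j.
  have dc : is_diff p (fun=> X p 0 j : K^o) (fun=> 0 : K^o) :=
    is_diff_cst (X p 0 j : K^o) p.
  apply: (is_diff_scale dc).
  exact/differentiableP/d2.
apply: is_diff_eq.
  apply: is_diff_sum => j; apply: is_diff_scale.
    exact: diff_coord.
  exact/differentiableP/d2.
apply/funext => w; rewrite big_split /= addrC; congr (_ + _).
  by rewrite [RHS]diff_row_sum.
apply: etrans (esym (congr1 (@^~ w) E2)).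
by apply: eq_bigr => j _; rewrite scale0r addr0.
Qed.

Definition dbracket A B : E -> E := fun p => 'd B p (A p) - 'd A p (B p).

Lemma dbracketC A B p : dbracket A B p = - dbracket B A p.
Proof. by rewrite /dbracket opprB. Qed.

Lemma dbracketxx A p : dbracket A A p = 0.
Proof. by rewrite /dbracket subrr. Qed.

Lemma dbracketE A B (dA dB : E -> E) p : is_diff p A dA -> is_diff p B dB ->
  dbracket A B p = dB (A p) - dA (B p).
Proof.
move=> [_ EA] [_ EB].
exact: (congr2 (fun h k : E -> E => h (A p) - k (B p)) EB EA).
Qed.

Lemma near_dbracket A A' B p : (\near p, A p = A' p) -> differentiable A p ->
  differentiable B p -> dbracket A' B p = dbracket A B p.
Proof.
move=> AA' /differentiableP dA /differentiableP dB.
rewrite (dbracketE (near_is_diff AA' dA) dB).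
by have <- : A p = A' p := nbhs_singleton AA'.
Qed.

Lemma dbracketDl A A' B p :
  differentiable A p -> differentiable A' p -> differentiable B p ->
  dbracket (fun q => A q + A' q) B p = dbracket A B p + dbracket A' B p.
Proof.
move=> /differentiableP dA /differentiableP dA' /differentiableP dB.
rewrite (dbracketE (is_diffD dA dA') dB) linearD.
by rewrite [(_ + _)(B p)]/(_ + _) opprD addrACA.
Qed.

Lemma dbracketZl (f : E -> K^o) A B p :
  differentiable f p -> differentiable A p -> differentiable B p ->
  dbracket (fun q => f q *: A q) B p = f p *: dbracket A B p - 'd f p (B p) *: A p.
Proof.
move=> /differentiableP df /differentiableP dA /differentiableP dB.
rewrite (dbracketE (is_diff_scale df dA) dB) scalerBr opprD addrA.
by congr (_ - _ - _); exact: linearZ.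
Qed.

Lemma dbracket_sum k (f : 'I_k -> E -> K^o) (A : 'I_k -> E -> E) B p :
  (forall j, differentiable (f j) p) -> (forall j, differentiable (A j) p) ->
  differentiable B p ->
  dbracket (fun q => \sum_j f j q *: A j q) B p =
  \sum_j (f j p *: dbracket (A j) B p - 'd (f j) p (B p) *: A j p).
Proof.
move=> df dA /differentiableP dB.
have dS : is_diff p (fun q => \sum_j f j q *: A j q)
    (fun v => \sum_j (f j p *: 'd (A j) p v + 'd (f j) p v *: A j p)).
  apply: is_diff_sum => j.
  exact: is_diff_scale (differentiableP (df j)) (differentiableP (dA j)).
rewrite (dbracketE dS dB).
apply: (etrans (congr1 (fun z => z - _) (linear_sum _ _ _ _))).
rewrite -sumrB; apply: eq_bigr => j _; rewrite scalerBr opprD addrA.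
by congr (_ - _ - _); exact: linearZ.
Qed.

Lemma k_diff_dbracket k U A B : open U ->
  k_diff k.+1 U A -> k_diff k.+1 U B -> k_diff k U (dbracket A B).
Proof.
move=> oU kA kB; apply: k_diff_add => //; last apply: k_diff_opp => //.
  by apply: k_diff_apply => //; exact: k_diff_pred.
by apply: k_diff_apply => //; exact: k_diff_pred.
Qed.

(* The chain rule produces second derivatives of [t], which cancel by [sym]. *)
Lemma related_dbracket U (t : E -> E) A B A' B' p : open U -> U p ->
  k_diff 2 U t ->
  (forall u v, 'd (fun q => 'd t q u) p v = 'd (fun q => 'd t q v) p u) ->
  (\near p, A' (t p) = 'd t p (A p)) -> (\near p, B' (t p) = 'd t p (B p)) ->
  differentiable A p -> differentiable B p ->
  differentiable A' (t p) -> differentiable B' (t p) ->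
  dbracket A' B' (t p) = 'd t p (dbracket A B p).
Proof.
move=> oU Up kt sym rA rB dA dB dA' dB'.
have dt : differentiable t p by case: kt => + _; apply.
(* The relation X' o t = dt(X) is differentiated at p in the direction Y p, by the chain rule on the
   left and by [is_diff_apply] on the right. *)
have key X X' Y Y' : (\near p, X' (t p) = 'd t p (X p)) ->
    (\near p, Y' (t p) = 'd t p (Y p)) ->
    differentiable X p -> differentiable X' (t p) ->
    'd X' (t p) (Y' (t p)) =
      'd t p ('d X p (Y p)) + 'd (fun q => 'd t q (X p)) p (Y p).
  move=> rX rY dX dX'; apply: etrans (congr1 _ (nbhs_singleton rY)) _.
  have h1 := is_diff_comp (differentiableP dt) (differentiableP dX').
  have h2 := is_diff_apply oU Up kt dX.
  exact: (congr1 (@^~ (Y p)) (is_diff_uniq (near_is_diff rX h1) h2)).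
have aux (a b c d e : E) : b = d -> e = a - c -> a + b - (c + d) = e.
  by move=> -> ->; rewrite opprD addrACA subrr addr0.
have keyB := key B B' A A' rB rA dB dB'.
have keyA := key A A' B B' rA rB dA dA'.
apply: etrans (congr2 (fun x y => x - y) keyB keyA) _.
by apply: aux; [exact: sym|exact: linearB].
Qed.

(** * Cramer's rule for the coefficients in a moving frame *)

Lemma k_diff_mul (V : normedModType K) k (U : set V) (f g : V -> K^o) : open U ->
  k_diff k U f -> k_diff k U g -> k_diff k U (fun x => f x * g x : K^o).
Proof. exact: k_diff_scale. Qed.

Lemma k_diff_det (V : normedModType K) k m (U : set V) (M : V -> 'M[K]_m) :
  open U -> (forall i j, k_diff k U (fun x => M x i j : K^o)) ->
  k_diff k U (fun x => \det (M x) : K^o).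
Proof.
move=> oU kM; apply: k_diff_sum => // s _; apply: k_diff_mul => //.
  exact: k_diff_cst.
by apply: k_diff_prod.
Qed.

Lemma open_neq0 (V : normedModType K) (U : set V) (f : V -> K^o) : open U ->
  (forall x, U x -> differentiable f x) -> open [set x | U x /\ f x != 0].
Proof.
move=> oU df; rewrite openE => x [Ux fx0].
have /= := differentiable_continuous (df _ Ux).
move=> /cvgrPdist_lt/(_ `|f x|); rewrite normr_gt0 => /(_ fx0) fn.
near=> y; split; first by near: y; exact: open_nbhs_nbhs.
have : `|f x - f y| < `|f x| by near: y.
by apply: contraTneq => ->; rewrite subr0 ltxx.
Unshelve. all: by end_near. Qed.

(* With a constant right inverse B of the matrix of the Z j at p0, W = f Z gives
   f = W B (Z B)^-1 wherever Z B is invertible. *)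
Lemma frame_coef k U (Z : 'I_k -> E -> E) W p0 : open U -> U p0 ->
  (forall j m, k_diff m U (Z j)) -> (forall m, k_diff m U W) ->
  (forall a : 'I_k -> K, \sum_j a j *: Z j p0 = 0 -> forall j, a j = 0) ->
  (forall p, U p -> exists a : 'I_k -> K, W p = \sum_j a j *: Z j p) ->
  exists (N : set E) (f : 'I_k -> E -> K^o),
    [/\ open N, N p0, N `<=` U, forall j m, k_diff m N (f j) &
        forall p, N p -> W p = \sum_j f j p *: Z j p].
Proof.
move=> oU Up0 kZ kW fZ sW.
pose M p := \matrix_(j < k) Z j p.
have mulM (a : 'rV_k) p : a *m M p = \sum_j a 0 j *: Z j p.
  by rewrite mulmx_sum_row; apply: eq_bigr => j _; rewrite rowK.
have /row_freeP[B MB] : row_free (M p0).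
  apply/inj_row_free => a; rewrite mulM => /fZ a0.
  by apply/rowP => j; rewrite a0 mxE.
pose G p := M p *m B.
have kG m i j : k_diff m U (fun p => G p i j : K^o).
  apply: (k_diff_ext (f := fun p => \sum_l Z i p 0 l * B l j : K^o)).
    by move=> p; rewrite [RHS]mxE; apply: eq_bigr => l _; rewrite mxE.
  apply: k_diff_sum => // l _; apply: k_diff_mul => //.
    exact: k_diff_coord.
  exact: k_diff_cst.
have kdet m : k_diff m U (fun p => \det (G p) : K^o) by exact: k_diff_det.
pose N := [set p | U p /\ \det (G p) != 0].
(* The inverse of G is written with the adjugate, whose entries are cofactors: the determinant is
   the only function to be inverted. *)
pose f (j : 'I_k) p : K^o := (\det (G p))^-1 * (W p *m B *m \adj (G p)) 0 j.
have oN : open N by apply: open_neq0 => //; have [] := kdet 1.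
have NU : N `<=` U by move=> p [].
exists N, f; split => //.
- by split => //; rewrite /G MB det1 oner_neq0.
- move=> j m; apply: k_diff_mul => //.
    apply: k_diff_inv => //; first by move=> p [].
    exact: k_diff_sub NU _.
  apply: (k_diff_sub NU).
  apply: (k_diff_ext (f := fun p =>
    \sum_i (\sum_l W p 0 l * B l i) * cofactor (G p) j i : K^o)).
    by move=> p; rewrite [RHS]mxE; apply: eq_bigr => i _; rewrite !mxE.
  apply: k_diff_sum => // i _; apply: k_diff_mul => //.
    apply: k_diff_sum => // l _; apply: k_diff_mul => //.
      exact: k_diff_coord.
    exact: k_diff_cst.
  apply: k_diff_mul => //; first exact: k_diff_cst.
  apply: k_diff_det => // i1 j1.
  by apply: k_diff_ext (kG m (lift j i1) (lift i j1)) => p; rewrite !mxE.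
(* The coefficients a at p come without regularity, but W = a M gives W B adj(G) = a G adj(G) =
   det(G) a, so they are the values of f. *)
- move=> p [Up d0]; have [a Wa] := sW p Up; rewrite {1}Wa.
  apply: eq_bigr => j _; congr (_ *: _).
  rewrite /f; have -> : W p = (\row_j a j) *m M p.
    by rewrite Wa mulM; apply: eq_bigr => l _; rewrite mxE.
  rewrite -(mulmxA _ (M p) B) -/(G p) -mulmxA mul_mx_adj mul_mx_scalar.
  by rewrite !mxE mulKf.
Qed.

End Chart.

(** * Symmetry of second derivatives *)

Section RealPart.
Variable R : realType.
Local Notation C := (Cplx R).

Definition toC (r : R) : C := real_complex R r.
Definition re (z : C) : R := complex.Re (z : R[i]).

Lemma toCD a b : toC (a + b) = toC a + toC b.
Proof. exact: (rmorphD (real_complex R)). Qed.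

Lemma toCM a b : toC (a * b) = toC a * toC b.
Proof. exact: (rmorphM (real_complex R)). Qed.

Lemma toC0 : toC 0 = 0.
Proof. by []. Qed.

Lemma toCI : injective toC.
Proof. exact: complexI. Qed.

Lemma reD x y : re (x + y) = re x + re y.
Proof. by case: x y => [a b] [c d]. Qed.

Lemma reN x : re (- x) = - re x.
Proof. by case: x. Qed.

Lemma reB x y : re (x - y) = re x - re y.
Proof. by rewrite reD reN. Qed.

Lemma reZ t x : re (toC t * x) = t * re x.
Proof. by case: x => a b; rewrite /re /= mul0r subr0. Qed.

Lemma toC_lt a b : (toC a < toC b) = (a < b).
Proof. exact: ltcR. Qed.

Lemma toC_le a b : (toC a <= toC b) = (a <= b).
Proof. exact: lecR. Qed.

Lemma toC_re (z : C) : 0 <= z -> z = toC (re z).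
Proof. by move=> z0; have := ger0_Im z0; case: z {z0} => a b /= ->. Qed.

Lemma norm_toC (t : R) : `|toC t| = toC `|t|.
Proof. by rewrite [LHS]normc_def /= expr0n /= addr0 sqrtr_sqr. Qed.

Lemma le_norm_re (z : C) (r : R) : `|z| <= toC r -> `|re z| <= r.
Proof.
by move=> zr; rewrite -toC_le; apply: le_trans zr; exact: normc_ge_Re.
Qed.

(** The real part of 'i z is minus the imaginary part of z; this lets complex identities be checked
    on real parts. *)
Lemma re_eq (x y : C) : re x = re y -> re ('i * x) = re ('i * y) -> x = y.
Proof.
rewrite (_ : 'i = Complex 0 1 :> R[i]); last by rewrite complexiE.
case: x y => [a b] [c d]; rewrite /re /= !mul0r !mul1r !sub0r => ->.
by move/oppr_inj => ->.
Qed.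

End RealPart.

Lemma linear_comb2 (K : numFieldType) (V : normedModType K) (L : {linear V -> K^o})
   (a b : K) (u v : V) : L (a *: u + b *: v) = a * L u + b * L v.
Proof. by rewrite linearD !linearZ. Qed.

Section Schwarz.
Variables (R : realType) (V : normedModType (Cplx R)).
Local Notation C := (Cplx R).

(** The norm of V takes its values in [Cplx R]; its real counterpart makes the order of R, and
    linear arithmetic over it, available for estimates. *)
Definition rnorm (w : V) : R := re `|w|.

Lemma rnormE w : `|w| = toC (rnorm w).
Proof. by apply: toC_re; exact: normr_ge0. Qed.

Lemma rnorm_ge0 w : 0 <= rnorm w.
Proof. by rewrite -toC_le -rnormE; exact: normr_ge0. Qed.

Lemma rnormD w w' : rnorm (w + w') <= rnorm w + rnorm w'.
Proof. by rewrite -toC_le toCD -!rnormE; exact: ler_normD. Qed.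

Lemma rnormZ t w : rnorm (toC t *: w) = `|t| * rnorm w.
Proof. by apply: toCI; rewrite -rnormE normrZ norm_toC rnormE toCM. Qed.

Lemma nbhs_rnorm (x : V) (P : V -> Prop) : (\near x, P x) ->
  exists2 d : R, 0 < d & forall w, rnorm w < d -> P (w + x).
Proof.
move=> /nbhs_normP[e e0 eP].
have eE := toC_re (ltW e0).
exists (re e); first by rewrite -toC_lt -eE.
move=> w wd; apply: eP; rewrite /ball_ /= opprD addrCA subrr addr0 normrN.
by rewrite rnormE eE toC_lt.
Qed.

Lemma re_diff (g : V -> C^o) x : differentiable g x ->
  forall e : R, 0 < e -> exists2 d : R, 0 < d & forall w, rnorm w < d ->
    `|re (g (w + x)) - re (g x) - re ('d g x w)| <= e * rnorm w.
Proof.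
move=> /diff_locally /eqaddoP dg e e0.
have /nbhs_rnorm[d d0 dP] : \forall z \near (0 : V),
    `|(g \o shift x - (cst (g x) + 'd g x)) z| <= toC e * `|z|.
  by apply: dg; rewrite -toC0 toC_lt.
exists d => // w /dP; rewrite addr0 rnormE -toCM => /le_norm_re.
by rewrite !fctE /= reB reD opprD addrA.
Qed.

Lemma re_derive (g : V -> C^o) (a u : V) (t : R) :
  differentiable g (a + toC t *: u) ->
  is_derive t (1 : R) (fun s => re (g (a + toC s *: u)))
    (re ('d g (a + toC t *: u) u)).
Proof.
move=> dg; set l := re _.
have cv : (fun h : R =>
    h^-1 *: (((fun s => re (g (a + toC s *: u))) \o shift t) (h *: 1)
      - re (g (a + toC t *: u)))) @ 0^' --> l.
  apply/cvgrPdist_le => e e0.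
  (* The added 1 keeps the divisor positive when u = 0. *)
  have nu : 0 < rnorm u + 1 by rewrite ltr_wpDl ?rnorm_ge0.
  have [d d0 dP] := re_diff dg (divr_gt0 e0 nu).
  near=> h.
  have h0 : h != 0 by near: h; exact: nbhs_dnbhs_neq.
  have hd : `|h| < d / (rnorm u + 1) by near: h; apply: dnbhs0_lt; exact: divr_gt0.
  have nh : rnorm (toC h *: u) <= `|h| * (rnorm u + 1).
    by rewrite rnormZ ler_wpM2l// lerDl.
  have /dP : rnorm (toC h *: u) < d.
    by apply: le_lt_trans nh _; rewrite -ltr_pdivlMr.
  rewrite linearZ /= reZ -/l.
  have -> : toC h *: u + (a + toC t *: u) = a + toC (h *: 1 + t) *: u.
    by rewrite addrCA -scalerDl -toCD [h *: 1]mulr1.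
  set q := re _; set q0 := re _ => qP.
  rewrite distrC [_ *: _]mulrC -[l](mulfK h0) -mulrBl normrM normfV.
  rewrite ler_pdivrMr ?normr_gt0// [l * h]mulrC.
  apply: le_trans qP _; apply: le_trans (ler_wpM2l _ nh) _; first exact/ltW/divr_gt0.
  by rewrite mulrCA divfK ?gt_eqF// mulrC.
apply: DeriveDef; first by apply/cvg_ex; exists l.
exact: cvg_lim cv.
Unshelve. all: by end_near. Qed.

(* The mean value theorem on s |-> f(p + tv + su) - f(p + su), whose derivative
   is t d(df(.)u)(v) + o(t) since q |-> df(q)u is differentiable at p. *)
Lemma second_difference (f : V -> C^o) (U : set V) (p u v : V) :
  open U -> U p -> (forall x, U x -> differentiable f x) ->
  differentiable (fun q => 'd f q u : C^o) p ->
  forall e : R, 0 < e -> exists2 d : R, 0 < d & forall t : R, 0 < t < d ->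
    `|re (f (p + toC t *: v + toC t *: u)) - re (f (p + toC t *: u))
      - (re (f (p + toC t *: v)) - re (f p))
      - t * (t * re ('d (fun q => 'd f q u : C^o) p v))| <= e * (t * t).
Proof.
move=> oU Up df dh e e0; pose h (q : V) : C^o := 'd f q u.
(* The displacements tv + cu and cu used below have norms at most t (|u| + |v|) and t |u|. Their sum
   is below t N, so errors of relative size e / N add up to at most e t; the 1 keeps N positive. *)
pose N := 2 * rnorm u + rnorm v + 1.
have N0 : 0 < N by have := rnorm_ge0 u; have := rnorm_ge0 v; rewrite /N; lra.
have [d1 d10 dP] := re_diff dh (divr_gt0 e0 N0).
have [d2 d20 dU] : exists2 d : R, 0 < d & forall w, rnorm w < d -> U (w + p).
  by apply: nbhs_rnorm; apply: open_nbhs_nbhs.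
(* [d1] keeps the points where the expansion of h at p is valid, [d2] keeps the segments inside
   U. *)
exists (Num.min d1 d2 / N); first by apply: divr_gt0 => //; rewrite lt_min d10.
move=> t /andP[t0 td].
have tN : t * N < d1 /\ t * N < d2.
  by move: td; rewrite ltr_pdivlMr// lt_min => /andP[].
have ns (s : R) w : 0 <= s <= t -> rnorm (toC s *: w) <= t * rnorm w.
  by case/andP=> s0 st; rewrite rnormZ ger0_norm// ler_wpM2r ?rnorm_ge0.
have b1 (s : R) : 0 <= s <= t -> rnorm (toC s *: u) <= t * rnorm u by exact: ns.
have tt : 0 <= t <= t by rewrite ltW/=.
have b2 (s : R) : 0 <= s <= t ->
    rnorm (toC t *: v + toC s *: u) <= t * (rnorm u + rnorm v).
  move=> st; apply: le_trans (rnormD _ _) _.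
  by have := ns _ u st; have := ns _ v tt; lra.
have c1 : t * rnorm u <= t * N.
  by rewrite ler_pM2l// /N; have := rnorm_ge0 u; have := rnorm_ge0 v; lra.
have c2 : t * (rnorm u + rnorm v) <= t * N.
  by rewrite ler_pM2l// /N; have := rnorm_ge0 u; have := rnorm_ge0 v; lra.
have U1 (s : R) : 0 <= s <= t -> U (p + toC s *: u).
  by move=> st; rewrite addrC; apply: dU; have := b1 _ st; case: tN => _; lra.
have U2 (s : R) : 0 <= s <= t -> U (p + toC t *: v + toC s *: u).
  by move=> st; rewrite -addrA addrC; apply: dU; have := b2 _ st; case: tN => _; lra.
pose psi (s : R) := re (f (p + toC t *: v + toC s *: u)) - re (f (p + toC s *: u)).
have dpsi (s : R) : 0 <= s <= t -> is_derive s (1 : R) psi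
    (re (h (p + toC t *: v + toC s *: u)) - re (h (p + toC s *: u))).
  move=> st; apply: is_deriveB.
    by apply: re_derive; apply: df; exact: U2.
  by apply: re_derive; apply: df; exact: U1.
have [c cI] : exists2 c, c \in `]0, t[%R & psi t - psi 0 =
    (re (h (p + toC t *: v + toC c *: u)) - re (h (p + toC c *: u))) * (t - 0).
  apply: MVT => //.
    by move=> s; rewrite in_itv/= => /andP[s0 st]; apply: dpsi; rewrite !ltW.
  apply: derivable_within_continuous => s; rewrite in_itv/= => st.
  by have [] := dpsi s st.
have ct : 0 <= c <= t by move: cI; rewrite in_itv/= => /andP[c0 ct]; rewrite !ltW.
rewrite subr0 /psi toC0 !scale0r !addr0 => psiE.
have h2 : rnorm (toC t *: v + toC c *: u) < d1 by have := b2 _ ct; case: tN; lra.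
have h1 : rnorm (toC c *: u) < d1 by have := b1 _ ct; case: tN; lra.
(* The first-order terms of h at the two points given by the mean value theorem are L(tv + cu) and
   L(cu); the unknown c cancels in their difference, which is t L(v). *)
pose L w := re ('d h p w).
have LE a b w w' : L (toC a *: w + toC b *: w') = a * L w + b * L w'.
  by rewrite /L linear_comb2 reD !reZ.
have LE1 : L (toC c *: u) = c * L u.
  by have := LE 0 c u u; rewrite toC0 scale0r add0r mul0r add0r.
have {h1}E1 :
  `|re (h (toC c *: u + p)) - re (h p) - L (toC c *: u)| <= _ := dP _ h1.
have {h2}E2 : `|re (h (toC t *: v + toC c *: u + p)) - re (h p) -
  L (toC t *: v + toC c *: u)| <= _ := dP _ h2.
rewrite LE1 [_ + p]addrC in E1; rewrite LE [_ + p]addrC addrA in E2.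
have eN : 0 < e / N by exact: divr_gt0.
have e2 := ler_wpM2l (ltW eN) (b2 _ ct).
have e1 := ler_wpM2l (ltW eN) (b1 _ ct).
rewrite {}psiE -/(L v).
move: E1 E2 => /le_trans/(_ e1) E1 /le_trans/(_ e2) E2.
rewrite mulrC -mulrBr normrM gtr0_norm// [e * _]mulrCA ler_pM2l//.
have -> : e * t =
    e / N * (t * (rnorm u + rnorm v)) + e / N * (t * rnorm u) + e / N * t.
  have {1}-> : e = e / N * N by rewrite divfK// gt_eqF.
  by rewrite {2}/N; ring.
have e3 : 0 <= e / N * t by rewrite ltW// mulr_gt0.
move: (rnorm u) (rnorm v) (L u) (L v) (e / N) e3 E1 E2 => nu nv lu lv k.
move: (re _) (re _) (re _) => x1 x2 x3.
clear; rewrite !ler_norml; lra.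
Qed.

(** The second difference of the real part of f is symmetric in u and v, so both second derivatives,
    multiplied by t^2, approximate the same number; with errors e/2 t^2 each, they differ by at most
    e for every e > 0. *)
Lemma second_diff_re (f : V -> C^o) (U : set V) (p u v : V) :
  open U -> U p -> k_diff 2 U f ->
  re ('d (fun q => 'd f q u) p v) = re ('d (fun q => 'd f q v) p u).
Proof.
move=> oU Up [df d2f].
set x := re _; set y := re _; apply/eqP; rewrite -subr_eq0 -normr_le0.
apply/ler_addgt0Pr => e e0; rewrite add0r.
have e20 : 0 < e / 2 by exact: divr_gt0.
have [d1 d10 H1] := second_difference v oU Up df ((d2f u).1 _ Up) e20.
have [d2 d20 H2] := second_difference u oU Up df ((d2f v).1 _ Up) e20.
pose t := Num.min d1 d2 / 2.
have [t0 t1 t2] : [/\ 0 < t, t < d1 & t < d2].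
  have m0 : 0 < Num.min d1 d2 by rewrite lt_min d10.
  have : t < Num.min d1 d2 by rewrite /t ltr_pdivrMr// ltr_pMr// ltr1n.
  by rewrite lt_min => /andP[? ?]; split => //; exact: divr_gt0.
have tt0 : 0 < t * t by exact: mulr_gt0.
have := H1 t; have := H2 t; rewrite t0 t1 t2 -/x -/y.
move=> /(_ isT) {}H2 /(_ isT) {}H1.
rewrite -(ler_pM2l tt0) -{1}(gtr0_norm tt0) -normrM.
rewrite [p + _ + _]addrAC in H2.
move: (re _) (re _) (re _) (re _) H1 H2 => a b c g; clear.
rewrite !ler_norml; lra.
Qed.

Lemma second_diff_sym0 (f : V -> C^o) (U : set V) (p u v : V) :
  open U -> U p -> k_diff 2 U f ->
  'd (fun q => 'd f q u) p v = 'd (fun q => 'd f q v) p u.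
Proof.
move=> oU Up kf; apply: re_eq; first exact: second_diff_re kf.
rewrite -!(@diff2_scale _ _ U f _ p _ _ oU Up kf).
apply: (@second_diff_re (fun y => 'i * f y : C^o) U p u v oU Up).
apply: (k_diff_ext _ (k_diff_scale oU (k_diff_cst 2 U ('i : C^o)) kf)).
by [].
Qed.

Lemma second_diff_sym n (f : V -> 'rV[C]_n) (U : set V) (p u v : V) :
  open U -> U p -> k_diff 2 U f ->
  'd (fun q => 'd f q u) p v = 'd (fun q => 'd f q v) p u.
Proof.
move=> oU Up kf; apply/rowP => j.
rewrite -!(@diff2_coord _ _ _ _ U f _ _ p _ _ oU Up kf).
apply: (@second_diff_sym0 (fun y => f y 0 j : C^o) U p u v oU Up).
exact: k_diff_coord.
Qed.

End Schwarz.

(** * Vector fields on a complex manifold *)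

Lemma near_diff_id (K : numFieldType) (V : normedModType K) (f : V -> V) p v :
  (\near p, f p = p) -> 'd f p v = v.
Proof.
move=> fp; have [_ dE] : is_diff p f id.
  by apply: (near_is_diff (f := id)); apply: filterS fp => q ->.
have h := congr1 (fun h : V -> V => h v) dE; exact: h.
Qed.

Lemma near_diff_comp (K : numFieldType) (U V W : normedModType K) (h : U -> W)
    (f : U -> V) (g : V -> W) p v :
  (\near p, g (f p) = h p) -> differentiable f p -> differentiable g (f p) ->
  'd h p v = 'd g (f p) ('d f p v).
Proof.
move=> gh /differentiableP df /differentiableP dg.
have [_ dE] : is_diff p h ('d g (f p) \o 'd f p).
  exact: (near_is_diff (f := g \o f)).
have e := congr1 (fun h : U -> W => h v) dE; exact: e.
Qed.

Lemma k_holoP (R : realType) (V W : normedModType (Cplx R)) k (U : set V)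
    (f : V -> W) : k_holomorphic k U f <-> k_diff k U f.
Proof.
elim: k f => [|k IH] f; first by split.
by split=> -[df kf]; split=> // v; apply/IH; exact: kf.
Qed.

Section Manifold.
Variables (R : realType) (n : nat) (M : complex_manifold R n).
Local Notation C := (Cplx R).
Local Notation E := 'rV[C]_n.
Implicit Types (U : set M) (i : chart_index M) (X Y Z : vfield M) (x : M).

Definition image U i : set E := chart i @` (U `&` chart_dom i).

Lemma image_chart U i x : U x -> chart_dom i x -> image U i (chart i x).
Proof. by move=> Ux ix; exists x. Qed.

Lemma chart_inv_image U i p : image U i p ->
  [/\ U (chart_inv i p), chart_dom i (chart_inv i p) & chart i (chart_inv i p) = p].
Proof. by move=> [x [Ux ix] <-]; rewrite !chartK. Qed.

Lemma image_open U i : open U -> open (image U i).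
Proof.
move=> oU.
have -> : image U i = (chart i @` chart_dom i) `&` chart_inv i @^-1` U.
  apply/seteqP; split=> p.
    by move=> [x [Ux ix] <-]; split; [exists x|rewrite /= chartK].
  by move=> [[x ix <-]]; rewrite /= chartK// => Ux; exists x.
have oD : open (chart i @` chart_dom i) := @chart_image_open _ _ M i.
have := @chart_inv_continuous _ _ M i.
rewrite (continuous_open_subspace _ oD) openE => ci p [Dp Up].
apply: filterI; first exact: open_nbhs_nbhs.
by apply: (ci p (mem_set Dp)); exact: open_nbhs_nbhs.
Qed.

Lemma near_image U i x (P : E -> Prop) : open U -> U x -> chart_dom i x ->
  (forall y, U y -> chart_dom i y -> P (chart i y)) -> \forall p \near chart i x, P p.
Proof.
move=> oU Ux ix UP.
apply: (near_open (U := image U i) (P := P)); first exact: image_open.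
  exact: image_chart.
by move=> _ [y [Uy iy] <-]; exact: UP.
Qed.

Local Notation trans i j := (chart (c:=M) j \o chart_inv i).

Lemma k_diff_trans k i j : k_diff k (image (chart_dom j) i) (trans i j).
Proof.
apply/k_holoP; rewrite /image setIC; exact: transition_holomorphic.
Qed.

Lemma trans_chart i j x : chart_dom i x -> trans i j (chart i x) = chart j x.
Proof. by move=> ix; rewrite /= chartK. Qed.

Lemma differentiable_trans i j x : chart_dom i x -> chart_dom j x ->
  differentiable (trans i j) (chart i x).
Proof.
move=> ix jx; have [+ _] := @k_diff_trans 1 i j; apply.
exact: image_chart.
Qed.

Lemma in_chartE i X x : chart_dom i x ->
  in_chart i X (chart i x) =
  'd (trans (chart_at x) i) (chart (chart_at x) x) (X x).
Proof. by move=> ix; rewrite /in_chart (chartK ix). Qed.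

Lemma diff_trans_id i x v : chart_dom i x -> 'd (trans i i) (chart i x) v = v.
Proof.
move=> ix.
apply: near_diff_id; apply: (near_image (chart_dom_open i) ix ix) => y _ iy.
exact: trans_chart.
Qed.

(** The cocycle identity for transition maps holds only on the overlap of the three charts, hence
    near the point, which suffices for the chain rule. *)
Lemma diff_trans i j l x v : chart_dom i x -> chart_dom j x -> chart_dom l x ->
  'd (trans i l) (chart i x) v =
  'd (trans j l) (chart j x) ('d (trans i j) (chart i x) v).
Proof.
move=> ix jx lx.
have dj := differentiable_trans ix jx.
have dl : differentiable (trans j l) (trans i j (chart i x)).
  rewrite (trans_chart j ix); exact: differentiable_trans.
have nE : \forall p \near chart i x, trans j l (trans i j p) = trans i l p.
  apply: (near_image (chart_dom_open j) jx ix) => y jy iy.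
  by rewrite (trans_chart j iy) (trans_chart l jy) (trans_chart l iy).
apply: etrans (near_diff_comp v nE dj dl) _.
by rewrite (trans_chart j ix).
Qed.

Lemma in_chart_at X x : in_chart (chart_at x) X (chart (chart_at x) x) = X x.
Proof. by rewrite in_chartE ?diff_trans_id//; exact: chart_at_dom. Qed.

Lemma in_chart_trans i j X x : chart_dom i x -> chart_dom j x ->
  in_chart j X (chart j x) = 'd (trans i j) (chart i x) (in_chart i X (chart i x)).
Proof.
move=> ix jx; rewrite !in_chartE//; apply: diff_trans => //.
exact: chart_at_dom.
Qed.

Lemma lieE X Y x : lie X Y x =
  dbracket (in_chart (chart_at x) X) (in_chart (chart_at x) Y)
    (chart (chart_at x) x).
Proof.
pose c := chart_at x; pose p := chart c x.
exact: (congr2 (fun u v : E => 'd (in_chart c Y) p u - 'd (in_chart c X) p v)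
  (esym (in_chart_at X x)) (esym (in_chart_at Y x))).
Qed.

Lemma lieC X Y x : lie X Y x = - lie Y X x.
Proof. by rewrite !lieE dbracketC. Qed.

Lemma liexx X x : lie X X x = 0.
Proof. by rewrite lieE dbracketxx. Qed.

Lemma holomorphic_fieldP U X :
  holomorphic_field U X <-> forall i k, k_diff k (image U i) (in_chart i X).
Proof. by split=> hX i k; apply/k_holoP; exact: hX. Qed.

Lemma differentiable_in_chart U i X x : holomorphic_field U X -> U x ->
  chart_dom i x -> differentiable (in_chart i X) (chart i x).
Proof.
move=> /holomorphic_fieldP hX Ux ix; have [+ _] := hX i 1; apply.
exact: image_chart.
Qed.

(** The transition map from [chart_at x] to i relates the two expressions of each field, so
    [related_dbracket] applies. The formula for [lie] then holds in one chart i for all nearby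
    points at once. *)
Lemma in_chart_lie U i X Y x : open U -> holomorphic_field U X ->
  holomorphic_field U Y -> U x -> chart_dom i x ->
  in_chart i (lie X Y) (chart i x) =
  dbracket (in_chart i X) (in_chart i Y) (chart i x).
Proof.
move=> oU hX hY Ux ix; set c := chart_at x.
have cx : chart_dom c x := chart_at_dom x.
pose D : set E := image (chart_dom i) c.
have oD : open D by exact: image_open (chart_dom_open i).
have Dx : D (chart c x) := image_chart ix cx.
have rel Z : nbhs (chart c x : E) (fun q : E =>
    in_chart i Z (trans c i q) = 'd (trans c i) q (in_chart c Z q)).
  apply: (near_image (chart_dom_open i) ix cx) => y iy cy.
  by rewrite (trans_chart i cy) (in_chart_trans Z cy iy).
have tx := trans_chart i cx.
have dt Z : holomorphic_field U Z -> differentiable (in_chart i Z) (trans c i (chart c x)).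
  by move=> hZ; rewrite tx; exact: differentiable_in_chart hZ Ux ix.
have kt := @k_diff_trans 2 c i.
have e := related_dbracket oD Dx kt
  (fun u v => second_diff_sym u v oD Dx kt) (rel X) (rel Y)
  (differentiable_in_chart hX Ux cx) (differentiable_in_chart hY Ux cx)
  (dt X hX) (dt Y hY).
rewrite tx in e; rewrite e in_chartE// -/c; congr ('d _ _ _); exact: lieE.
Qed.

Lemma holomorphic_field_eq U X Y : open U -> (forall x, U x -> X x = Y x) ->
  holomorphic_field U X -> holomorphic_field U Y.
Proof.
move=> oU XY /holomorphic_fieldP hX; apply/holomorphic_fieldP => i k.
apply: k_diff_eq (image_open oU) _ (hX i k) => p /chart_inv_image[Up _ _].
by rewrite /in_chart XY.
Qed.

Lemma holomorphic_field_sub U N X : N `<=` U ->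
  holomorphic_field U X -> holomorphic_field N X.
Proof.
move=> NU /holomorphic_fieldP hX; apply/holomorphic_fieldP => i k.
by apply: k_diff_sub (hX i k) => p [x [/NU Ux ix] <-]; exists x.
Qed.

Lemma holomorphic_lie U X Y : open U -> holomorphic_field U X ->
  holomorphic_field U Y -> holomorphic_field U (lie X Y).
Proof.
move=> oU hX hY; apply/holomorphic_fieldP => i k.
have /holomorphic_fieldP kX := hX; have /holomorphic_fieldP kY := hY.
apply: (k_diff_eq (image_open oU) _ (k_diff_dbracket (image_open oU) (kX i k.+1) (kY i k.+1))).
by move=> p [x [Ux ix] <-]; rewrite (in_chart_lie oU hX hY Ux ix).
Qed.

Lemma in_chart_scale i (f : M -> C) X p :
  in_chart i (fun x => f x *: X x) p = f (chart_inv i p) *: in_chart i X p.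
Proof. exact: linearZ. Qed.

Lemma in_chartD i X Y p :
  in_chart i (fun x => X x + Y x) p = in_chart i X p + in_chart i Y p.
Proof. exact: linearD. Qed.

Lemma holomorphic_fieldZ U (a : C) X : open U ->
  holomorphic_field U X -> holomorphic_field U (fun x => a *: X x).
Proof.
move=> oU /holomorphic_fieldP hX; apply/holomorphic_fieldP => i k.
apply: (k_diff_ext _ (k_diff_scale (image_open oU) (k_diff_cst k _ (a : C^o)) (hX i k))).
by move=> p; rewrite (in_chart_scale i (fun=> a)).
Qed.

Lemma holomorphic_fieldD U X Y : open U -> holomorphic_field U X ->
  holomorphic_field U Y -> holomorphic_field U (fun x => X x + Y x).
Proof.
move=> oU /holomorphic_fieldP hX /holomorphic_fieldP hY.
apply/holomorphic_fieldP => i k.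
apply: (k_diff_ext _ (k_diff_add (image_open oU) (hX i k) (hY i k))).
by move=> p; rewrite in_chartD.
Qed.

Lemma lie_near U X X' Y x : open U -> U x ->
  holomorphic_field U X -> holomorphic_field U Y ->
  (forall y, U y -> X y = X' y) -> lie X' Y x = lie X Y x.
Proof.
move=> oU Ux hX hY XX'; have cx := chart_at_dom x.
rewrite !lieE; apply: near_dbracket.
- apply: (near_image oU Ux cx) => y Uy cy.
  by rewrite /in_chart chartK// XX'.
- exact: differentiable_in_chart hX Ux cx.
- exact: differentiable_in_chart hY Ux cx.
Qed.

Lemma lieDl U X X' Y x : U x -> holomorphic_field U X ->
  holomorphic_field U X' -> holomorphic_field U Y ->
  lie (fun y => X y + X' y) Y x = lie X Y x + lie X' Y x.
Proof.
move=> Ux hX hX' hY; have cx := chart_at_dom x.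
have -> : lie (fun y => X y + X' y) Y x = dbracket
    (fun q => in_chart (chart_at x) X q + in_chart (chart_at x) X' q)
    (in_chart (chart_at x) Y) (chart (chart_at x) x).
  rewrite lieE; congr (dbracket _ _ _).
  by apply/funext => q; exact: in_chartD.
rewrite !lieE; apply: dbracketDl.
- exact: differentiable_in_chart hX Ux cx.
- exact: differentiable_in_chart hX' Ux cx.
- exact: differentiable_in_chart hY Ux cx.
Qed.

(** The number d is - Y(f) at x. It is left unspecified because only the direction X x of the extra
    term counts once proj_V is applied. *)
Lemma lieZl U (f : M -> C) X Y x : U x -> holomorphic_fun U f ->
  holomorphic_field U X -> holomorphic_field U Y ->
  exists d : C, lie (fun y => f y *: X y) Y x = f x *: lie X Y x + d *: X x.
Proof.
move=> Ux hf hX hY; have cx := chart_at_dom x.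
set c := chart_at x in cx *; pose g : E -> C^o := f \o chart_inv c.
have dg : differentiable g (chart c x).
  by have /k_holoP[+ _] := hf c 1; apply; exact: image_chart.
have -> : lie (fun y => f y *: X y) Y x = dbracket
    (fun q => g q *: in_chart c X q) (in_chart c Y) (chart c x).
  rewrite lieE; congr (dbracket _ _ _).
  by apply/funext => q; exact: in_chart_scale.
exists (- 'd g (chart c x) (in_chart c Y (chart c x))).
apply: (etrans (dbracketZl dg (differentiable_in_chart hX Ux cx)
  (differentiable_in_chart hY Ux cx))).
rewrite lieE -/c scaleNr; congr (_ *: _ - _ *: _); last exact: in_chart_at.
by rewrite /g /= chartK.
Qed.

Lemma holomorphic_field_scale U (f : M -> C) X : open U ->
  holomorphic_fun U f -> holomorphic_field U X ->
  holomorphic_field U (fun x => f x *: X x).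
Proof.
move=> oU hf /holomorphic_fieldP hX; apply/holomorphic_fieldP => i k.
have kf : k_diff k (image U i) (f \o chart_inv i : E -> C^o) by apply/k_holoP; exact: hf.
apply: (k_diff_ext _ (k_diff_scale (image_open oU) kf (hX i k))).
by move=> p; rewrite in_chart_scale.
Qed.

Lemma diff_trans_inj i x : chart_dom i x ->
  injective ('d (trans (chart_at x) i) (chart (chart_at x) x)).
Proof.
move=> ix u v uv; have cx := chart_at_dom x.
apply: etrans (esym (diff_trans_id u cx)) _.
apply: etrans (diff_trans u cx ix cx) _.
apply: etrans (congr1 _ uv) _.
apply: etrans (esym (diff_trans v cx ix cx)) _.
exact: diff_trans_id.
Qed.

(** * Holomorphic frames on the manifold *)

Definition free_at k (Z : 'I_k -> vfield M) x :=
  forall a : 'I_k -> C, \sum_j a j *: Z j x = 0 -> forall j, a j = 0.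

Lemma diff_trans_comb k (Z : 'I_k -> vfield M) (a : 'I_k -> C) i x :
  chart_dom i x -> 'd (trans (chart_at x) i) (chart (chart_at x) x)
    (\sum_j a j *: Z j x) = \sum_j a j *: in_chart i (Z j) (chart i x).
Proof.
move=> ix; apply: (etrans (linear_sum _ _ _ _)).
apply: eq_bigr => j _; rewrite in_chartE//; exact: linearZ.
Qed.

(** Differentials of transition maps are injective and linear, so independence and expansions pass
    between tangent spaces and chart. Independence at x alone suffices, as it persists nearby. *)
Lemma frame_in_chart k U i (Z : 'I_k -> vfield M) X x : open U -> U x ->
  chart_dom i x -> (forall j, holomorphic_field U (Z j)) ->
  holomorphic_field U X -> free_at Z x ->
  (forall y, U y -> exists a : 'I_k -> C, X y = \sum_j a j *: Z j y) ->
  exists (N : set E) (f : 'I_k -> E -> C^o),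
    [/\ open N, N (chart i x), N `<=` image U i, forall j m, k_diff m N (f j) &
        forall p, N p -> X (chart_inv i p) = \sum_j f j p *: Z j (chart_inv i p)].
Proof.
move=> oU Ux ix hZ /holomorphic_fieldP hX fZ sX.
have hZ' j m : k_diff m (image U i) (in_chart i (Z j)).
  by have /holomorphic_fieldP := hZ j; apply.
have free : forall a : 'I_k -> C,
    \sum_j a j *: in_chart i (Z j) (chart i x) = 0 -> forall j, a j = 0.
  move=> a a0; apply: fZ; apply: (diff_trans_inj ix).
  by apply: etrans (diff_trans_comb Z a ix) _; rewrite a0 linear0.
have span p : image U i p -> exists a : 'I_k -> C,
    in_chart i X p = \sum_j a j *: in_chart i (Z j) p.
  move=> [y [Uy iy] <-]; have [a Xa] := sX y Uy; exists a.
  by rewrite (in_chartE X iy) Xa; exact: diff_trans_comb.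
have [N [f [oN Nx NU kf Xf]]] :=
  frame_coef (image_open oU) (image_chart Ux ix) hZ' (hX i) free span.
exists N, f; split=> // p Np.
have [_ iy pE] := chart_inv_image (NU _ Np).
apply: (diff_trans_inj iy); rewrite -(in_chartE X iy) pE.
by apply: etrans (Xf p Np) _; rewrite (diff_trans_comb _ _ iy) pE.
Qed.

(** The coefficients are differentiable near x, so the Leibniz rule applies termwise; [d] collects
    their derivatives along Y, with a minus sign. *)
Lemma lie_frame k U (Z : 'I_k -> vfield M) X Y x : open U -> U x ->
  (forall j, holomorphic_field U (Z j)) -> holomorphic_field U X ->
  holomorphic_field U Y -> free_at Z x ->
  (forall y, U y -> exists a : 'I_k -> C, X y = \sum_j a j *: Z j y) ->
  exists a d : 'I_k -> C, X x = \sum_j a j *: Z j x /\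
    lie X Y x = \sum_j (a j *: lie (Z j) Y x + d j *: Z j x).
Proof.
move=> oU Ux hZ hX hY fZ sX; have cx := chart_at_dom x.
have [N [f [oN Nx NU kf Xf]]] := frame_in_chart oU Ux cx hZ hX fZ sX.
set c := chart_at x in cx N f oN Nx NU kf Xf *; set p := chart c x in Nx *.
have dY := differentiable_in_chart hY Ux cx.
have dX := differentiable_in_chart hX Ux cx.
have dZ j := differentiable_in_chart (hZ j) Ux cx.
have df j : differentiable (f j) p by have [+ _] := kf j 1; apply.
have XN : nbhs p (fun q : E => in_chart c X q = \sum_j f j q *: in_chart c (Z j) q).
  apply: (near_open (U := N)) => // q Nq.
  have [_ iy qE] := chart_inv_image (NU _ Nq).
  rewrite -[in LHS]qE (in_chartE X iy) (Xf _ Nq) (diff_trans_comb _ _ iy).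
  by rewrite qE.
exists (fun j => f j p), (fun j => - 'd (f j) p (in_chart c Y p)); split.
  by have := Xf p Nx; rewrite chartK.
rewrite lieE -/c -/p.
apply: (etrans (esym (near_dbracket XN dX dY))).
apply: (etrans (dbracket_sum df dZ dY)).
apply: eq_bigr => j _; rewrite lieE scaleNr; congr (_ - _ *: _).
exact: in_chart_at.
Qed.

(** The coefficients in the hypothesis are chosen point by point; freeness forces them to agree with
    the holomorphic coefficients that exist locally. *)
Lemma holomorphic_component k U (Z : 'I_k -> vfield M) X P j0 : open U ->
  (forall j, holomorphic_field U (Z j)) -> holomorphic_field U X ->
  (forall y, U y -> free_at Z y) ->
  (forall y, U y -> exists2 a : 'I_k -> C,
    X y = \sum_j a j *: Z j y & P y = a j0 *: Z j0 y) ->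
  holomorphic_field U P.
Proof.
move=> oU hZ hX fZ sP; apply/holomorphic_fieldP => i k'.
apply: k_diff_local => _ [x [Ux ix] <-].
have sX y : U y -> exists a : 'I_k -> C, X y = \sum_j a j *: Z j y.
  by move=> /sP[a Xa _]; exists a.
have [N [f [oN Nx NU kf Xf]]] := frame_in_chart oU Ux ix hZ hX (fZ _ Ux) sX.
exists N; split=> //.
have /holomorphic_fieldP/(_ i k') kZ := hZ j0.
apply: (k_diff_eq oN _ (k_diff_scale oN (kf j0 k') (k_diff_sub NU kZ))) => p Np.
have [Uy iy pE] := chart_inv_image (NU _ Np).
have [a Xa Pa] := sP _ Uy.
have fa : f j0 p = a j0.
  apply/eqP; rewrite -subr_eq0; apply/eqP.
  apply: (fZ _ Uy (fun j => f j p - a j)).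
  under eq_bigr do rewrite scalerBl.
  by rewrite sumrB -Xa -Xf// subrr.
rewrite -[in RHS]pE (in_chartE P iy) Pa fa -[in LHS]pE (in_chartE _ iy).
by apply: esym; exact: linearZ.
Qed.

End Manifold.

(** * Projections and line fields *)

Section Projection.
Variables (K : fieldType) (vT : vectType K) (U V : {vspace vT}).
Hypothesis UV : directv (U + V).

Let dUV : (U :&: V)%VS = 0%VS := directv_addP UV.

Lemma daddv_pi_eq0 w : w \in V -> daddv_pi U V w = 0.
Proof.
move=> wV.
have dVU : (V :&: U)%VS = 0%VS by rewrite capvC.
have wD : w \in (U + V)%VS by rewrite (subvP (addvSr U V)).
have := daddv_pi_add dUV wD; rewrite (daddv_pi_id dVU wV).
by move/(canRL (addrK _)); rewrite subrr.
Qed.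

Lemma daddv_pi_kernel w : w \in (U + V)%VS -> daddv_pi U V w = 0 -> w \in V.
Proof.
move=> wD w0; have := daddv_pi_add dUV wD; rewrite w0 add0r => <-.
exact: memv_pi.
Qed.

Lemma daddv_piE u v : u \in U -> v \in V -> daddv_pi U V (u + v) = u.
Proof.
by move=> uU vV; rewrite linearD /= (daddv_pi_id dUV uU) daddv_pi_eq0// addr0.
Qed.

Lemma daddv_pi_addl w z : w \in V -> daddv_pi U V (w + z) = daddv_pi U V z.
Proof. by move=> wV; rewrite linearD /= daddv_pi_eq0// add0r. Qed.

(** Shaped after the Leibniz rule: u and z stand for the brackets of two fields with a third, and d
    w for the derivative of the coefficient times a vector of S. *)
Lemma daddv_pi_comb a d u w z : w \in V ->
  daddv_pi U V (a *: u + d *: w + z) = a *: daddv_pi U V u + daddv_pi U V z.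
Proof.
move=> wV; rewrite addrAC addrC daddv_pi_addl ?memvZ//.
by rewrite linearP.
Qed.

Lemma directv_eq0 u v : u \in U -> v \in V -> u + v = 0 -> u = 0 /\ v = 0.
Proof.
move=> uU vV uv; have := daddv_piE uU vV; rewrite uv linear0 => u0.
by move: uv; rewrite -u0 add0r.
Qed.

End Projection.

Section Lines.
Variables (R : realType) (n : nat) (M : complex_manifold R n).
Local Notation C := (Cplx R).
Implicit Types (U N : set M) (X Y : vfield M) (x : M) (L : subspaces M).

Lemma line_frame L x : Defs.distribution 1 L -> exists (U : set M) (v : vfield M),
  [/\ open U, U x, holomorphic_field U v & forall y, U y -> L y = <[v y]>%VS].
Proof.
move=> [_ /(_ x)[U [X [oU Ux hX LX]]]]; exists U, (tnth X ord0); split=> //.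
move=> y Uy; rewrite (LX y Uy) -span_seq1; congr <<_>>%VS.
by rewrite /= enum_ordSl enum_ord0.
Qed.

Lemma line_frame_neq0 L x (v : vfield M) : Defs.distribution 1 L ->
  L x = <[v x]>%VS -> v x != 0.
Proof.
by move=> [dL _] Lv; have := dL x; rewrite Lv dim_vline; case: eqP.
Qed.

Lemma is_section_sub L U N X : N `<=` U -> is_section L U X -> is_section L N X.
Proof.
move=> NU [hX LX]; split; first exact: holomorphic_field_sub hX.
by move=> y /NU; exact: LX.
Qed.

(** A constant multiple of a local frame of the line field takes the prescribed value. *)
Lemma section_through L x (u : 'rV[C]_n) : Defs.distribution 1 L -> u \in L x ->
  exists (U : set M) (X : vfield M),
    [/\ open U, U x, is_section L U X & X x = u].
Proof.
move=> dL; have [U [v [oU Ux hv Lv]]] := line_frame x dL.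
rewrite (Lv x Ux) => /vlineP[a ->]; exists U, (fun y => a *: v y); split=> //.
split; first exact: holomorphic_fieldZ.
by move=> y Uy; rewrite (Lv y Uy) memvZ// memv_line.
Qed.

Lemma holomorphic_field_local U X :
  (forall x, U x -> exists N, [/\ open N, N x & holomorphic_field N X]) ->
  holomorphic_field U X.
Proof.
move=> loc; apply/holomorphic_fieldP => i k.
apply: k_diff_local => _ [x [Ux ix] <-].
have [N [oN Nx /holomorphic_fieldP hX]] := loc x Ux.
by exists (image N i); split; [exact: image_chart|exact: hX].
Qed.

End Lines.

(** * Families and sums indexed by two or three elements *)

Definition pick2 T (a b : T) (j : 'I_2) : T := if val j is 0%N then a else b.
Definition pick3 T (a b c : T) (j : 'I_3) : T :=
  match val j with 0%N => a | 1%N => b | _ => c end.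

Lemma sum2 (W : nmodType) (F : 'I_2 -> W) : \sum_j F j = F ord0 + F (inord 1).
Proof.
rewrite !big_ord_recl big_ord0 addr0; congr (F _ + F _).
by apply: val_inj; rewrite /= inordK.
Qed.

Lemma sum3 (W : nmodType) (F : 'I_3 -> W) :
  \sum_j F j = F ord0 + F (inord 1) + F (inord 2).
Proof.
rewrite !big_ord_recl big_ord0 addr0 addrA; congr (F _ + F _ + F _);
by apply: val_inj; rewrite /= inordK.
Qed.

Lemma pick2E T (a b : T) : (pick2 a b ord0 = a) * (pick2 a b (inord 1) = b).
Proof. by rewrite /pick2 /= inordK. Qed.

Lemma pick3E T (a b c : T) :
  (pick3 a b c ord0 = a) * (pick3 a b c (inord 1) = b) * (pick3 a b c (inord 2) = c).
Proof. by rewrite /pick3 /= !inordK. Qed.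

Lemma ord2P (P : 'I_2 -> Prop) : P ord0 -> P (inord 1) -> forall j, P j.
Proof.
move=> P0 P1 [[|[|//]] lt]; [move: P0|move: P1]; congr P; apply: val_inj => //=.
by rewrite inordK.
Qed.

Lemma ord3P (P : 'I_3 -> Prop) : P ord0 -> P (inord 1) -> P (inord 2) ->
  forall j, P j.
Proof.
move=> P0 P1 P2 [[|[|[|//]]] lt]; [move: P0|move: P1|move: P2]; congr P;
  apply: val_inj => //=; by rewrite inordK.
Qed.

(** * The map Phi *)

Section LineDecomposition.
Variables (R : realType) (M : complex_manifold R 6).
Local Notation C := (Cplx R).
Local Notation E := 'rV[C]_6.
Variables D S V L1 L2 : subspaces M.
Hypothesis dV : Defs.distribution 1 V.
Hypothesis dL1 : Defs.distribution 1 L1.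
Hypothesis dL2 : Defs.distribution 1 L2.
Hypothesis hVS : forall x, directv (V x + S x) /\ (V x + S x)%VS = D x.
Hypothesis hL : forall x, directv (L1 x + L2 x) /\ (L1 x + L2 x)%VS = S x.
Hypothesis hSD : forall (U : set M) (X Y : vfield M), open U ->
  is_section S U X -> is_section S U Y -> field_in D U (lie X Y).
Implicit Types (U N : set M) (X Y : vfield M) (x : M).

Lemma L1_sub x w : w \in L1 x -> w \in S x.
Proof. by have [_ <-] := hL x; apply: subvP; exact: addvSl. Qed.

Lemma L2_sub x w : w \in L2 x -> w \in S x.
Proof. by have [_ <-] := hL x; apply: subvP; exact: addvSr. Qed.

Lemma section_L1 U X : is_section L1 U X -> is_section S U X.
Proof. by move=> [hX LX]; split=> // y /LX/L1_sub. Qed.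

Lemma section_L2 U X : is_section L2 U X -> is_section S U X.
Proof. by move=> [hX LX]; split=> // y /LX/L2_sub. Qed.

Lemma lie_D U X Y : open U -> is_section L1 U X -> is_section L2 U Y ->
  field_in D U (lie X Y).
Proof. by move=> oU /section_L1 sX /section_L2 sY; exact: hSD. Qed.

Lemma projV_eq0 Z x : Z x \in S x -> projV V S Z x = 0.
Proof. by move=> Zx; apply: daddv_pi_eq0 => //; have [] := hVS x. Qed.

Lemma line_frames x : exists U (v s1 s2 : vfield M),
  [/\ open U, U x, [/\ holomorphic_field U v, holomorphic_field U s1 &
      holomorphic_field U s2] & forall y, U y ->
      [/\ V y = <[v y]>%VS, L1 y = <[s1 y]>%VS & L2 y = <[s2 y]>%VS]].
Proof.
have [U0 [v [oU0 U0x hv Vv]]] := line_frame x dV.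
have [U1 [s1 [oU1 U1x h1 L1s]]] := line_frame x dL1.
have [U2 [s2 [oU2 U2x h2 L2s]]] := line_frame x dL2.
exists (U0 `&` U1 `&` U2), v, s1, s2; split.
- by apply: openI => //; exact: openI.
- by [].
- by split; [move: hv|move: h1|move: h2]; apply: holomorphic_field_sub => y [[]].
- by move=> y [[/Vv ? /L1s ?] /L2s ?].
Qed.

Lemma free_line L (v : vfield M) x : Defs.distribution 1 L -> L x = <[v x]>%VS ->
  free_at (fun _ : 'I_1 => v) x.
Proof.
move=> dL Lv a; rewrite big_ord1 => /eqP.
rewrite scaler_eq0 (negPf (line_frame_neq0 dL Lv)) orbF => /eqP a0 j.
by rewrite ord1.
Qed.

Lemma free_lines (s1 s2 : vfield M) x :
  L1 x = <[s1 x]>%VS -> L2 x = <[s2 x]>%VS -> free_at (pick2 s1 s2) x.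
Proof.
move=> e1 e2 a; rewrite sum2 !(pick2E s1 s2).
have [dL _] := hL x.
have m1 : a ord0 *: s1 x \in L1 x by rewrite e1 memvZ// memv_line.
have m2 : a (inord 1) *: s2 x \in L2 x by rewrite e2 memvZ// memv_line.
move=> /(directv_eq0 dL m1 m2)[/eqP + /eqP].
rewrite !scaler_eq0 (negPf (line_frame_neq0 dL1 e1)).
rewrite (negPf (line_frame_neq0 dL2 e2)) !orbF => /eqP a0 /eqP a1.
exact: ord2P.
Qed.

Lemma span_S (s1 s2 : vfield M) x w :
  L1 x = <[s1 x]>%VS -> L2 x = <[s2 x]>%VS -> w \in S x ->
  exists a : 'I_2 -> C, w = \sum_j a j *: pick2 s1 s2 j x.
Proof.
move=> e1 e2; have [_ <-] := hL x; rewrite e1 e2.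
move=> /memv_addP[_ /vlineP[a ->] [_ /vlineP[b ->] ->]].
exists (pick2 a b).
by rewrite sum2 !(pick2E s1 s2) !(pick2E a b).
Qed.

(* Near x, X = f v with f(x) = 0, so that [X, Y] = - Y(f) v at x. *)
Lemma lie_vanishing L U X Y x : Defs.distribution 1 L -> open U -> U x ->
  is_section L U X -> holomorphic_field U Y -> X x = 0 -> lie X Y x \in L x.
Proof.
move=> dL oU Ux sX hY X0.
have [N [v [oN Nx hv Lv]]] := line_frame x dL.
have oW : open (U `&` N) by exact: openI.
have [hX LX] : is_section L (U `&` N) X by apply: is_section_sub sX => y [].
have hv' : holomorphic_field (U `&` N) v by apply: holomorphic_field_sub hv => y [].
have hY' : holomorphic_field (U `&` N) Y by apply: holomorphic_field_sub hY => y [].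
have fv := free_line dL (Lv x Nx).
have sp y : (U `&` N) y ->
    exists a : 'I_1 -> C, X y = \sum_j a j *: (fun=> v) j y.
  move=> [Uy Ny]; have := LX y (conj Uy Ny).
  by rewrite (Lv y Ny) => /vlineP[c ->]; exists (fun=> c); rewrite big_ord1.
have [a [d [Xx ->]]] := lie_frame oW (conj Ux Nx) (fun=> hv') hX hY' fv sp.
rewrite X0 big_ord1 in Xx.
have a0 : a ord0 = 0 by apply: (fv a); rewrite big_ord1.
by rewrite big_ord1 a0 scale0r add0r (Lv x Nx) memvZ// memv_line.
Qed.

Lemma section_comb L U (a : C) X Y : open U -> is_section L U X ->
  is_section L U Y -> is_section L U (fun y => a *: X y + Y y).
Proof.
move=> oU [hX LX] [hY LY]; split=> [|y Uy].
  by apply: holomorphic_fieldD => //; exact: holomorphic_fieldZ.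
by rewrite memvD ?LY// memvZ// LX.
Qed.

(** * Tensoriality of the projected bracket *)

Lemma projV_lieC X Y x : projV V S (lie X Y) x = - projV V S (lie Y X) x.
Proof. by rewrite /projV lieC linearN. Qed.

(** The difference of X and X' is a section of L vanishing at x, so its bracket with Y has at x a
    value in L x, inside S x, which the projection kills. *)
Lemma projV_lie_ext L U X X' Y x : Defs.distribution 1 L ->
  (forall x w, w \in L x -> w \in S x) -> open U -> U x ->
  is_section L U X -> is_section L U X' -> holomorphic_field U Y ->
  X x = X' x -> projV V S (lie X Y) x = projV V S (lie X' Y) x.
Proof.
move=> dL LS oU Ux sX sX' hY XX'.
pose X0 : vfield M := fun y => (-1) *: X' y + X y.
have sX0 : is_section L U X0 by exact: section_comb.
have X00 : X0 x = 0 by rewrite /X0 XX' scaleN1r addNr.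
have e : lie X Y x = lie X0 Y x + lie X' Y x.
  rewrite -(lieDl Ux sX0.1 sX'.1 hY); apply: (lie_near oU Ux) => //.
    by apply: holomorphic_fieldD => //; [exact: sX0.1|exact: sX'.1].
  by move=> y _; rewrite /X0 scaleN1r addrAC addNr add0r.
rewrite /projV e; apply: daddv_pi_addl; first by have [] := hVS x.
by apply: LS; exact: lie_vanishing dL oU Ux sX0 hY X00.
Qed.

Lemma projV_lie_ext2 U X X' Y Y' x : open U -> U x ->
  is_section L1 U X -> is_section L1 U X' ->
  is_section L2 U Y -> is_section L2 U Y' ->
  X x = X' x -> Y x = Y' x ->
  projV V S (lie X Y) x = projV V S (lie X' Y') x.
Proof.
move=> oU Ux sX sX' sY sY' XX' YY'.
rewrite (projV_lie_ext dL1 L1_sub oU Ux sX sX' sY.1 XX') projV_lieC.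
by rewrite (projV_lie_ext dL2 L2_sub oU Ux sY sY' sX'.1 YY') -projV_lieC.
Qed.

Lemma projV_lie_linear (L : subspaces M) U (f : M -> C) X X' Y x :
  (forall x w, w \in L x -> w \in S x) -> open U -> U x ->
  is_section L U X -> is_section L U X' -> holomorphic_field U Y ->
  holomorphic_fun U f ->
  projV V S (lie (fun y => f y *: X y + X' y) Y) x =
  f x *: projV V S (lie X Y) x + projV V S (lie X' Y) x.
Proof.
move=> LS oU Ux sX sX' hY hf.
have hfX : holomorphic_field U (fun y => f y *: X y).
  by apply: holomorphic_field_scale => //; exact: sX.1.
have [d e] := lieZl Ux hf sX.1 hY.
rewrite /projV (lieDl Ux hfX sX'.1 hY) e.
apply: daddv_pi_comb; first by have [] := hVS x.
by apply: LS; exact: sX.2.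
Qed.

Lemma is_section_projV_lie U X Y : open U -> is_section L1 U X ->
  is_section L2 U Y -> is_section V U (projV V S (lie X Y)).
Proof.
move=> oU sX sY; split; last by move=> y _; exact: memv_pi.
apply: holomorphic_field_local => x Ux.
have [N [v [s1 [s2 [oN Nx [hv h1 h2] fr]]]]] := line_frames x.
exists (U `&` N); split=> //; first exact: openI.
have oW : open (U `&` N) by exact: openI.
have sub X' : holomorphic_field N X' -> holomorphic_field (U `&` N) X'.
  by apply: holomorphic_field_sub => y [].
(* Since V, L1 and L2 together span D, the fields v, s1, s2 frame D, and the projection onto V is
   the component of index [ord0]. *)
apply: (holomorphic_component (Z := pick3 v s1 s2) (X := lie X Y) (j0 := ord0)) => //.
- by apply: ord3P; rewrite pick3E; exact: sub.
- apply: (holomorphic_field_sub (U := U)); first by move=> y [].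
  by apply: holomorphic_lie => //; [exact: sX.1|exact: sY.1].
- move=> y [_ /fr[eV e1 e2]] a; rewrite sum3 !pick3E -addrA.
  have m0 : a ord0 *: v y \in V y by rewrite eV memvZ// memv_line.
  have m1 : a (inord 1) *: s1 y \in L1 y by rewrite e1 memvZ// memv_line.
  have m2 : a (inord 2) *: s2 y \in L2 y by rewrite e2 memvZ// memv_line.
  have m12 : a (inord 1) *: s1 y + a (inord 2) *: s2 y \in S y.
    by rewrite memvD ?(L1_sub m1) ?(L2_sub m2).
  move=> /(directv_eq0 (hVS y).1 m0 m12)[/eqP + /(directv_eq0 (hL y).1 m1 m2)[/eqP + /eqP]].
  rewrite !scaler_eq0 (negPf (line_frame_neq0 dV eV)).
  rewrite (negPf (line_frame_neq0 dL1 e1)) (negPf (line_frame_neq0 dL2 e2)) !orbF.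
  by move=> /eqP a0 /eqP a1 /eqP a2; exact: ord3P.
- move=> y [Uy /fr[eV e1 e2]].
  have := lie_D oU sX sY Uy; rewrite -(hVS y).2.
  move=> /memv_addP[w wV [w' w'S e]]; rewrite /projV e (daddv_piE (hVS y).1 wV w'S).
  move: wV; rewrite eV => /vlineP[a wE].
  move: w'S; rewrite -(hL y).2 e1 e2.
  move=> /memv_addP[_ /vlineP[b ->] [_ /vlineP[c ->] w'E]].
  exists (pick3 a b c); last by rewrite !pick3E.
  by rewrite sum3 !pick3E -addrA -wE -w'E.
Qed.

Definition tensor_value x (u v : E) : set E := [set w | exists U X Y,
  [/\ open U, U x, is_section L1 U X, is_section L2 U Y &
      [/\ X x = u, Y x = v & w = projV V S (lie X Y) x]]].

(** [tensor_value] gathers the projected brackets of all local sections through u and v. It is empty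
    unless u is in L1 x and v in L2 x, and the default 0 is taken only there. *)
Definition Phi x (u v : E) : E := xget 0 (tensor_value x u v).

(** All elements of [tensor_value] coincide: two pairs of sections are restricted to their common
    domain and compared by [projV_lie_ext2]. *)
Lemma PhiE U X Y x : open U -> is_section L1 U X -> is_section L2 U Y -> U x ->
  Phi x (X x) (Y x) = projV V S (lie X Y) x.
Proof.
move=> oU sX sY Ux; apply: xget_unique; first by exists U, X, Y.
move=> _ [N [X' [Y' [oN Nx sX' sY' [Xx Yx ->]]]]].
have NI : U `&` N `<=` N by move=> y [].
have UI : U `&` N `<=` U by move=> y [].
apply: (projV_lie_ext2 (openI oU oN) (conj Ux Nx)) => //.
- exact: is_section_sub NI sX'.
- exact: is_section_sub UI sX.
- exact: is_section_sub NI sY'.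
- exact: is_section_sub UI sY.
Qed.

(** Linearity in either argument compares up to two vectors of one line with one of the other; all
    extensions are brought to one domain. *)
Lemma common_sections x (u u' v v' : E) : u \in L1 x -> u' \in L1 x ->
  v \in L2 x -> v' \in L2 x -> exists U X X' Y Y',
  [/\ open U, U x, is_section L1 U X /\ is_section L1 U X',
      is_section L2 U Y /\ is_section L2 U Y' &
      [/\ X x = u, X' x = u', Y x = v & Y' x = v']].
Proof.
move=> /(section_through dL1)[A [X [oA Ax sX Xx]]].
move=> /(section_through dL1)[B [X' [oB Bx sX' X'x]]].
move=> /(section_through dL2)[A' [Y [oA' A'x sY Yx]]].
move=> /(section_through dL2)[B' [Y' [oB' B'x sY' Y'x]]].
exists ((A `&` B) `&` (A' `&` B')), X, X', Y, Y'; split=> //.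
- by apply: openI; exact: openI.
- by split; [apply: is_section_sub sX|apply: is_section_sub sX'] => y [[]].
- by split; [apply: is_section_sub sY|apply: is_section_sub sY'] => y [_ []].
Qed.

Lemma holomorphic_fun_cst U (a : C) : open U -> holomorphic_fun U (fun=> a).
Proof. by move=> oU i k; apply/k_holoP; exact: k_diff_cst. Qed.

Lemma Phi_bundle_map : tensor_bundle_map L1 L2 V Phi.
Proof.
split.
- move=> x u v uL vL.
  have [U [X [_ [Y [_ [oU Ux [sX _] [sY _] [<- _ <- _]]]]]]] := common_sections uL uL vL vL.
  by rewrite (PhiE oU sX sY Ux); exact: memv_pi.
- move=> x a u u' v uL uL' vL.
  have [U [X [X' [Y [_ [oU Ux [sX sX'] [sY _] [<- <- <- _]]]]]]] := common_sections uL uL' vL vL.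
  rewrite (PhiE oU sX sY Ux) (PhiE oU sX' sY Ux).
  rewrite (PhiE (X := fun y => a *: X y + X' y) oU (section_comb a oU sX sX') sY Ux).
  exact: (projV_lie_linear L1_sub oU Ux sX sX' sY.1 (holomorphic_fun_cst a oU)).
- move=> x a u v v' uL vL vL'.
  have [U [X [_ [Y [Y' [oU Ux [sX _] [sY sY'] [<- _ <- <-]]]]]]] := common_sections uL uL vL vL'.
  rewrite (PhiE oU sX sY Ux) (PhiE oU sX sY' Ux).
  rewrite (PhiE (Y := fun y => a *: Y y + Y' y) oU sX (section_comb a oU sY sY') Ux).
  (* Antisymmetry moves the combination to the first argument, where the Leibniz rule is
     available. *)
  rewrite projV_lieC.
  rewrite (projV_lie_linear L2_sub oU Ux sY sY' sX.1 (holomorphic_fun_cst a oU)).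
  have opp (p q p' q' : E) : p' = - p -> q' = - q -> - (a *: p + q) = a *: p' + q'.
    by move=> -> ->; rewrite opprD scalerN.
  by apply: opp; exact: projV_lieC.
- move=> U X Y oU sX sY.
  have [hP inP] := is_section_projV_lie oU sX sY.
  split; last by move=> x Ux; rewrite (PhiE oU sX sY Ux); exact: inP.
  by apply: (holomorphic_field_eq oU _ hP) => x Ux; rewrite (PhiE oU sX sY Ux).
Qed.

Lemma Phi_unique Psi :
  (forall U X Y, open U -> is_section L1 U X -> is_section L2 U Y ->
     forall x, U x -> Psi x (X x) (Y x) = projV V S (lie X Y) x) ->
  eq_on_tensor L1 L2 Psi Phi.
Proof.
move=> PsiE x u v uL vL.
have [U [X [_ [Y [_ [oU Ux [sX _] [sY _] [<- _ <- _]]]]]]] := common_sections uL uL vL vL.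
by rewrite (PhiE oU sX sY Ux) (PsiE _ _ _ oU sX sY _ Ux).
Qed.

(** With X expanded in s1, s2, the derivatives of the coefficients contribute only multiples of s1
    and s2, which lie in S; what remains is a combination of the brackets of s1 and s2 with Y. *)
Lemma lie_S_expand U (s1 s2 : vfield M) X Y x : open U -> U x ->
  holomorphic_field U s1 -> holomorphic_field U s2 ->
  (forall y, U y -> L1 y = <[s1 y]>%VS /\ L2 y = <[s2 y]>%VS) ->
  is_section S U X -> holomorphic_field U Y ->
  lie s1 Y x \in S x -> lie s2 Y x \in S x -> lie X Y x \in S x.
Proof.
move=> oU Ux h1 h2 eL [hX SX] hY m1 m2.
have hZ j : holomorphic_field U (pick2 s1 s2 j).
  by move: j; apply: ord2P; rewrite pick2E.
have [e1 e2] := eL x Ux.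
have sp y (Uy : U y) := span_S (eL y Uy).1 (eL y Uy).2 (SX y Uy).
have [a [d [_ ->]]] := lie_frame oU Ux hZ hX hY (free_lines e1 e2) sp.
rewrite sum2 !pick2E; have [s1S s2S] : s1 x \in S x /\ s2 x \in S x.
  by rewrite (L1_sub (w := s1 x)) ?(L2_sub (w := s2 x)) ?e1 ?e2 ?memv_line.
by apply: memvD; apply: memvD; apply: memvZ; [exact: m1|exact: s1S|exact: m2|exact: s2S].
Qed.

Lemma frobenius_Phi :
  frobenius_integrable S <-> eq_on_tensor L1 L2 Phi (fun _ _ _ => 0).
Proof.
split=> [fS x u v uL vL|P0 U X Y oU sX sY x Ux].
  have [U [X [_ [Y [_ [oU Ux [sX _] [sY _] [<- _ <- _]]]]]]] := common_sections uL uL vL vL.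
  rewrite (PhiE oU sX sY Ux); apply: projV_eq0.
  exact: (fS U X Y oU (section_L1 sX) (section_L2 sY) x Ux).
have [N [v [s1 [s2 [oN Nx [_ h1 h2] fr]]]]] := line_frames x.
have oW : open (U `&` N) by exact: openI.
have Wx : (U `&` N) x by [].
have WU : U `&` N `<=` U by move=> y [].
have eL y : (U `&` N) y -> L1 y = <[s1 y]>%VS /\ L2 y = <[s2 y]>%VS.
  by move=> [_ /fr[]].
have hN Z : holomorphic_field N Z -> holomorphic_field (U `&` N) Z.
  by apply: holomorphic_field_sub => y [].
move: (h1) (h2) => /hN h1' /hN h2'.
have sX' : is_section S (U `&` N) X by exact: is_section_sub sX.
have sY' : is_section S (U `&` N) Y by exact: is_section_sub sY.
have sec1 : is_section L1 (U `&` N) s1.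
  by split=> // y /eL[-> _]; exact: memv_line.
have sec2 : is_section L2 (U `&` N) s2.
  by split=> // y /eL[_ ->]; exact: memv_line.
(* The bracket lies in D, and on D = V + S the kernel of the projection onto V is S. *)
have m12 : lie s1 s2 x \in S x.
  apply: (daddv_pi_kernel (hVS x).1).
    by rewrite (hVS x).2; exact: lie_D oW sec1 sec2 x Wx.
  apply: etrans (esym (PhiE oW sec1 sec2 Wx)) _.
  exact: P0 (sec1.2 x Wx) (sec2.2 x Wx).
have m21 : lie s2 s1 x \in S x by rewrite lieC memvN.
have expand := lie_S_expand oW Wx h1' h2' eL.
have m0 (Z : vfield M) : lie Z Z x \in S x by rewrite liexx mem0v.
(* X is expanded against Y; then, with the brackets reversed, Y is expanded against s1 and against
   s2, which leaves only brackets among s1 and s2. *)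
apply: (expand _ _ sX' sY'.1); rewrite lieC memvN.
  exact: (expand _ _ sY' h1' (m0 s1) m21).
exact: (expand _ _ sY' h2' m12 (m0 s2)).
Qed.

End LineDecomposition.

Theorem corollary2p5 (R : realType) (M : complex_manifold R 6)
    (D D2 S V L1 L2 : subspaces M)
    (hD : borel_geometry D D2)
    (hS : is_sqrtD D S) (hV : is_V D D2 V)
    (hVS : forall x : M, directv (V x + S x) /\ (V x + S x)%VS = D x)
    (hL : null_lines D2 V S L1 L2) :
  (* (X, Y) |-> proj_V [X, Y] takes values in sections of V and is tensorial *)
  (forall (U : set M) (X Y : vfield M), open U ->
     is_section L1 U X -> is_section L2 U Y ->
     field_in D U (lie X Y) /\ is_section V U (projV V S (lie X Y))) /\
  (forall (U : set M) (X X' Y : vfield M) (f : M -> Cplx R), open U ->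
     is_section L1 U X -> is_section L1 U X' -> is_section L2 U Y ->
     holomorphic_fun U f ->
     forall x, U x ->
       projV V S (lie (fun y => f y *: X y + X' y) Y) x =
       f x *: projV V S (lie X Y) x + projV V S (lie X' Y) x) /\
  (forall (U : set M) (X Y Y' : vfield M) (f : M -> Cplx R), open U ->
     is_section L1 U X -> is_section L2 U Y -> is_section L2 U Y' ->
     holomorphic_fun U f ->
     forall x, U x ->
       projV V S (lie X (fun y => f y *: Y y + Y' y)) x =
       f x *: projV V S (lie X Y) x + projV V S (lie X Y') x) /\
  (* it determines a bundle map Phi, whose vanishing is the integrability of S *)
  (exists Phi : M -> 'rV[Cplx R]_6 -> 'rV[Cplx R]_6 -> 'rV[Cplx R]_6,
     [/\ tensor_bundle_map L1 L2 V Phi,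
         forall (U : set M) (X Y : vfield M), open U ->
           is_section L1 U X -> is_section L2 U Y ->
           forall x, U x -> Phi x (X x) (Y x) = projV V S (lie X Y) x,
         forall Psi : M -> 'rV[Cplx R]_6 -> 'rV[Cplx R]_6 -> 'rV[Cplx R]_6,
           tensor_bundle_map L1 L2 V Psi ->
           (forall (U : set M) (X Y : vfield M), open U ->
              is_section L1 U X -> is_section L2 U Y ->
              forall x, U x -> Psi x (X x) (Y x) = projV V S (lie X Y) x) ->
           eq_on_tensor L1 L2 Psi Phi &
         frobenius_integrable S <-> eq_on_tensor L1 L2 Phi (fun _ _ _ => 0)]).
Proof.
have [_ _ hSD] := hS; have [dV _ _] := hV; have [d1 d2 hL12 _] := hL.
split.
  move=> U X Y oU sX sY; split; first exact: (lie_D hL12 hSD oU sX sY).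
  exact: (is_section_projV_lie dV d1 d2 hVS hL12 hSD oU sX sY).
split.
  move=> U X X' Y f oU sX sX' sY hf x Ux.
  exact: (projV_lie_linear hVS (L1_sub hL12) oU Ux sX sX' sY.1 hf).
split.
  move=> U X Y Y' f oU sX sY sY' hf x Ux.
  have e := projV_lie_linear hVS (L2_sub hL12) oU Ux sY sY' sX.1 hf.
  apply: etrans (projV_lieC _ _ _ _ _) _; apply: etrans (congr1 -%R e) _.
  rewrite opprD -scalerN.
  by congr (_ *: _ + _); apply: esym; exact: projV_lieC.
exists (Phi S V L1 L2); split.
- exact: Phi_bundle_map dV d1 d2 hVS hL12 hSD.
- move=> U X Y oU sX sY x Ux.
  exact (PhiE d1 d2 hVS hL12 oU sX sY Ux).
- move=> Psi _ PsiE; exact (Phi_unique d1 d2 hVS hL12 PsiE).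
- exact: frobenius_Phi dV d1 d2 hVS hL12 hSD.
Qed.
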